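(* Let $S=\{n\in\mathbb{Z}: n\in[-1000,-100)\cup(100,1000],\ n^2+n+7 \text{ squarefree}\}$. For $n\in S$, let $f(x)=x^6+(n^2+5)x^4+(n^2+2n+6)x^2+1$, $\xi$ a root of $f$, $K=\mathbb{Q}(\xi)$, $\alpha=\xi^2$ (a root of $x^3+(n^2+5)x^2+(n^2+2n+6)x+1$), $L=\mathbb{Q}(\alpha)$, and $\beta=\frac{\alpha^2+(n^2-n+3)\alpha+n^2}{n^2+n-1}$, with $(1,\alpha,\beta)$ being an integral basis of $L$ and hence $(1,\alpha,\beta,i,i\alpha,i\beta)$ an integral basis of $\mathbb{Z}_K$. Then for every $n\in S$ there is no element $\gamma=x_1+x_2\alpha+x_3\beta+iy_1+iy_2\alpha+iy_3\beta$ with $x_1,x_2,x_3,y_1,y_2,y_3\in\mathbb{Z}$ and $|x_2|,|x_3|,|y_1|,|y_2|,|y_3|<10^{100}$ that generates a power integral basis of $K$, i.e. with $\mathbb{Z}_K=\mathbb{Z}[\gamma]$.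
   Context: $\mathbb{Z}_K$ is the ring of integers of $K$; $\gamma\in\mathbb{Z}_K$ generates a power integral basis if $(1,\gamma,\dots,\gamma^5)$ is a $\mathbb{Z}$-basis of $\mathbb{Z}_K$. $K$ contains $\mathbb{Q}(i)$ and is the composite of $L$ and $\mathbb{Q}(i)$. *)

(* Defs.v *)
From HB Require Import structures.
From mathcomp Require Import all_boot all_order all_algebra all_field.

Set Implicit Arguments.
Unset Strict Implicit.
Unset Printing Implicit Defensive.

Import Order.TTheory GRing.Theory Num.Theory.
Local Open Scope ring_scope.

Definition squarefree (m : int) : Prop :=
  forall d : int, (d ^+ 2 %| m)%Z -> `|d| = 1.

Definition inS (n : int) : Prop :=
  ((-1000 <= n) && (n < -100) || (100 < n) && (n <= 1000))
  /\ squarefree (n ^+ 2 + n + 7).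

Definition sextic (n : int) : {poly int} :=
  'X^6 + (n ^+ 2 + 5)%:P * 'X^4 + (n ^+ 2 + 2 * n + 6)%:P * 'X^2 + 1.

Definition cubic (n : int) : {poly int} :=
  'X^3 + (n ^+ 2 + 5)%:P * 'X^2 + (n ^+ 2 + 2 * n + 6)%:P * 'X + 1.

Section NumberField.

Variable K : fieldExtType rat.

(* The ring of integers of the subfield F. *)
Definition algebraic_integers (F : {vspace K}) (x : K) : Prop :=
  x \in F /\ integralOver (intr : int -> K) x.

Definition is_Zbasis (O : K -> Prop) (d : nat) (b : d.-tuple K) : Prop :=
  (forall x : K,
     O x <-> exists c : 'I_d -> int, x = \sum_(j < d) tnth b j *~ c j)
  /\ (forall c : 'I_d -> int,
        \sum_(j < d) tnth b j *~ c j = 0 -> forall j, c j = 0).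

Definition integral_basis (F : {vspace K}) (d : nat) (b : d.-tuple K) : Prop :=
  is_Zbasis (algebraic_integers F) b.

(* Stated for fields K of degree 6. *)
Definition power_integral_basis (g : K) : Prop :=
  integral_basis fullv [tuple g ^+ j | j < 6].

Definition beta_of (n : int) (a : K) : K :=
  (a ^+ 2 + (n ^+ 2 - n + 3)%:~R * a + (n ^+ 2)%:~R)
    / (n ^+ 2 + n - 1)%:~R.

End NumberField.

(* Main.v *)
From Stdlib Require Import ZArith.
Require Import Defs.
From HB Require Import structures.
From mathcomp Require Import all_boot all_order all_algebra all_field.
From mathcomp Require Import zify ring.

Set Implicit Arguments.
Unset Strict Implicit.
Unset Printing Implicit Defensive.

Import Order.TTheory GRing.Theory Num.Theory.
Local Open Scope ring_scope.

(* With t = beta - 1 one has alpha = - t^2, and t is a root of the simplest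
   cubic x^3 - (n-1) x^2 - (n+2) x - 1, whose discriminant is m^2 for
   m = n^2 + n + 7.  As m is squarefree and odd, the ring of integers of L is
   Z[t] and that of K = L(i), i = xi / t, is Z[t, i].

   Suppose g = a + i b, with a, b in Z[t], generates Z[t, i].  For each
   automorphism f of K, g - f g divides x - f x for every algebraic integer x.
   Complex conjugation shows that b is a unit, the rotation s : t |-> t' fixing i shows
   that g - s g is t - t' times a unit, and their composite shows that
   (a - s a) + i (b + s b) is a unit, since it divides both 2 i and t - t', and
   N(t - t') = - m is odd.  A unit of Z[t, i] is real or purely imaginary over
   the totally real field L, so a = s a, b + s b is a unit, and b generates
   Z[t].  If x^3 - T x^2 + S x - N is the characteristic polynomial of b, then
   N = 1 or -1, T S - N = 1 or -1 and the discriminant is m^2.  For |n| > 100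
   this leaves T S = 0, hence 4 s^3 = m^2 + 27 for an integer s, which is
   excluded by computation for |n| <= 1000. *)

(** * Simplest cubic polynomials *)

(** The map u |-> -1/(1 + u) permutes the roots of the simplest cubic cyclically; [conj1] and
    [conj2] are -1/(1 + t) and -(1 + t)/t reduced modulo the cubic. *)
Definition conj1 (R : comNzRingType) (n t : R) : R := t ^+ 2 - n * t - 2.

Definition conj2 (R : comNzRingType) (n t : R) : R :=
  - t ^+ 2 + (n - 1) * t + n + 1.

Definition conductor (R : comNzRingType) (n : R) : R := n ^+ 2 + n + 7.

(* e1, e2, e3 are the elementary symmetric functions of the conjugates of t. *)
Definition norm_sym (R : comNzRingType) (e1 e2 e3 c0 c1 c2 : R) : R :=
  c0 ^+ 3 + c0 ^+ 2 * c1 * e1 + c0 ^+ 2 * c2 * (e1 ^+ 2 - 2 * e2)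
  + c0 * c1 ^+ 2 * e2 + c0 * c1 * c2 * (e1 * e2 - 3 * e3)
  + c0 * c2 ^+ 2 * (e2 ^+ 2 - 2 * e1 * e3) + c1 ^+ 3 * e3
  + c1 ^+ 2 * c2 * e1 * e3 + c1 * c2 ^+ 2 * e2 * e3 + c2 ^+ 3 * e3 ^+ 2.

Definition normf (R : comNzRingType) (n c0 c1 c2 : R) : R :=
  norm_sym (n - 1) (- (n + 2)) 1 c0 c1 c2.

Definition tracef (R : comNzRingType) (n c0 c1 c2 : R) : R :=
  3 * c0 + (n - 1) * c1 + (n ^+ 2 + 5) * c2.

Section SimplestCubic.

Variables (R : comNzRingType) (n t : R).
Hypothesis t_root : t ^+ 3 = (n - 1) * t ^+ 2 + (n + 2) * t + 1.
Let t1 := conj1 n t.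
Let t2 := conj2 n t.

(** An identity that needs the cubic relation becomes a plain [ring] identity once the quotient q of
    its division by the cubic is supplied. *)
Lemma mod_cubic q x y :
  x - y = q * (t ^+ 3 - ((n - 1) * t ^+ 2 + (n + 2) * t + 1)) -> x = y.
Proof. by rewrite t_root subrr mulr0 => /eqP; rewrite subr_eq0 => /eqP. Qed.

Lemma conj_sum : t + t1 + t2 = n - 1.
Proof. by rewrite /t1 /t2 /conj1 /conj2; ring. Qed.

Lemma conj_sum2 : t * t1 + t1 * t2 + t2 * t = - (n + 2).
Proof. by apply: (@mod_cubic (n - t)); rewrite /t1 /t2 /conj1 /conj2; ring. Qed.

Lemma conj_prod : t * t1 * t2 = 1.
Proof.
apply: (@mod_cubic (- t ^+ 2 + n * t + 1)).
by rewrite /t1 /t2 /conj1 /conj2; ring.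
Qed.

Lemma conj1_root : t1 ^+ 3 = (n - 1) * t1 ^+ 2 + (n + 2) * t1 + 1.
Proof.
(* With the coefficients replaced by symmetric functions, the claim is that t1 is a root of (X -
   t)(X - t1)(X - t2). *)
rewrite -[n + 2]opprK -conj_sum2 -conj_sum.
by rewrite -[X in _ = _ + _ + X]conj_prod; ring.
Qed.

Lemma conj11 : conj1 n t1 = t2.
Proof.
by apply: (@mod_cubic (t - n - 1)); rewrite /t1 /t2 /conj1 /conj2; ring.
Qed.

Lemma conj12 : conj1 n t2 = t.
Proof.
apply: (@mod_cubic (t - n + 1)).
rewrite /t1 /t2 /conj1 /conj2; ring.
Qed.

Lemma vandermonde : (t - t1) * (t1 - t2) * (t2 - t) = - conductor n.
Proof.
apply: (@mod_cubic (2 * t ^+ 3 - 4 * n * t ^+ 2 + 2 * n ^+ 2 * t + t ^+ 2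
  - 2 * n * t + n ^+ 2 - 9 * t + 7 * n - 1)).
by rewrite /t1 /t2 /conj1 /conj2 /conductor; ring.
Qed.

Lemma normfE c0 c1 c2 :
  (c0 + c1 * t + c2 * t ^+ 2) * (c0 + c1 * t1 + c2 * t1 ^+ 2)
    * (c0 + c1 * t2 + c2 * t2 ^+ 2) = normf n c0 c1 c2.
Proof.
rewrite /normf -conj_sum -conj_sum2 -[X in norm_sym _ _ X]conj_prod.
by rewrite /norm_sym; ring.
Qed.

Lemma tracefE c0 c1 c2 :
  (c0 + c1 * t + c2 * t ^+ 2) + (c0 + c1 * t1 + c2 * t1 ^+ 2)
    + (c0 + c1 * t2 + c2 * t2 ^+ 2) = tracef n c0 c1 c2.
Proof.
have -> : tracef n c0 c1 c2
  = 3 * c0 + (n - 1) * c1 + ((n - 1) ^+ 2 - 2 * (- (n + 2))) * c2.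
  by rewrite /tracef; ring.
rewrite -conj_sum -conj_sum2; ring.
Qed.

End SimplestCubic.

(* On the trace-zero lattice the trace form is proportional to the hexagonal
   form x^2 - x y + y^2, whence the sum of squares. *)
Lemma tracef_sqr_ge0 (n c0 c1 c2 d0 d1 d2 : int) :
  d0 = c0 ^+ 2 + (n - 1) * c2 ^+ 2 + 2 * c1 * c2 ->
  d1 = 2 * c0 * c1 + (n ^+ 2 + n - 1) * c2 ^+ 2 + 2 * (n + 2) * c1 * c2 ->
  d2 = c1 ^+ 2 + 2 * c0 * c2 + (n ^+ 2 - n + 3) * c2 ^+ 2
       + 2 * (n - 1) * c1 * c2 ->
  0 <= tracef n d0 d1 d2.
Proof.
(* The three substituted values are the coefficients of the square of c0 + c1 t + c2 t^2. *)
move=> -> -> ->.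
rewrite -(@pmulr_rge0 _ 6) //.
set T := tracef n c0 c1 c2.
set u := c1 + n * c2.
have -> : 6 * tracef n (c0 ^+ 2 + (n - 1) * c2 ^+ 2 + 2 * c1 * c2)
  (2 * c0 * c1 + (n ^+ 2 + n - 1) * c2 ^+ 2 + 2 * (n + 2) * c1 * c2)
  (c1 ^+ 2 + 2 * c0 * c2 + (n ^+ 2 - n + 3) * c2 ^+ 2 + 2 * (n - 1) * c1 * c2)
  = 2 * T ^+ 2 + 2 * conductor n * (u ^+ 2 + c2 ^+ 2 + (u - c2) ^+ 2).
  by rewrite /T /u /tracef /conductor; ring.
have m_ge0 : 0 <= conductor n by rewrite /conductor; nia.
apply: addr_ge0; first exact: (mulr_ge0 _ (sqr_ge0 T)).
apply: mulr_ge0; first exact: mulr_ge0.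
exact: (addr_ge0 (addr_ge0 (sqr_ge0 _) (sqr_ge0 _)) (sqr_ge0 _)).
Qed.

(** * Arithmetic modulo 2 *)

Lemma F2_cases (x : 'F_2) : x = 0 \/ x = 1.
Proof. by case: x => [[|[|//]] xlt]; [left | right]; apply/val_inj. Qed.

Lemma F2_even (x : int) : x%:~R = 0 :> 'F_2 <-> exists y, x = 2 * y.
Proof.
have dvd2 := dvdz_pcharf (pchar_Fp (isT : prime 2)) x.
split=> [/eqP|[y Ex]]; last by apply/eqP; rewrite -dvd2 Ex dvdz_mulr.
by rewrite -dvd2 => /dvdzP[y ->]; exists y; rewrite mulrC.
Qed.

(** The prime 2 is inert: the cubic has no root modulo 2 for either parity of n, so over F_2 the
    norm form vanishes only at 0. All sixteen cases are evaluated. *)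
Lemma normf_even (n c0 c1 c2 q : int) : normf n c0 c1 c2 = 2 * q ->
  exists d0 d1 d2 : int, [/\ c0 = 2 * d0, c1 = 2 * d1 & c2 = 2 * d2].
Proof.
move=> H; have : (normf n c0 c1 c2)%:~R = 0 :> 'F_2 by apply/F2_even; exists q.
have -> : (normf n c0 c1 c2)%:~R
  = normf n%:~R c0%:~R c1%:~R c2%:~R :> 'F_2 by rewrite /normf /norm_sym; ring.
have : [/\ c0%:~R = 0 :> 'F_2, c1%:~R = 0 :> 'F_2 & c2%:~R = 0 :> 'F_2] ->
  exists d0 d1 d2 : int, [/\ c0 = 2 * d0, c1 = 2 * d1 & c2 = 2 * d2].
  by case=> /F2_even[d0 ->] /F2_even[d1 ->] /F2_even[d2 ->]; exists d0, d1, d2.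
move=> concl eqN; apply: concl; move: eqN.
by case: (F2_cases n%:~R) => ->; case: (F2_cases c0%:~R) => ->;
  case: (F2_cases c1%:~R) => ->; case: (F2_cases c2%:~R) => -> /eqP;
  rewrite /normf /norm_sym.
Qed.

(** Infinite descent at the inert prime 2: a zero of the norm form can be halved for ever. This
    stands in for irreducibility of the cubic over Q. *)
Lemma normf_eq0 (n c0 c1 c2 : int) :
  normf n c0 c1 c2 = 0 -> [/\ c0 = 0, c1 = 0 & c2 = 0].
Proof.
have [k] := ubnP (`|c0| + `|c1| + `|c2|)%N.
elim: k c0 c1 c2 => // k IH c0 c1 c2 lek N0.
have [|d0 [d1 [d2 [E0 E1 E2]]]] := @normf_even n c0 c1 c2 0; first by rewrite N0.
have N0' : normf n d0 d1 d2 = 0.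
  move: N0; rewrite E0 E1 E2.
  have -> : normf n (2 * d0) (2 * d1) (2 * d2) = 8 * normf n d0 d1 d2.
    by rewrite /normf /norm_sym; ring.
  by move/eqP; rewrite mulf_eq0 => /orP[|/eqP].
have [c00|c0n0] := eqVneq (`|c0| + `|c1| + `|c2|)%N 0%N; first by split; lia.
by have [|D0 D1 D2] := IH d0 d1 d2 _ N0'; [lia | split; lia].
Qed.

(** Z[t]/2 is a field, so an element whose square is divisible by 2 is itself divisible by 2. *)
Lemma sqr_even (n c0 c1 c2 d0 d1 d2 : int) :
  c0 ^+ 2 + (n - 1) * c2 ^+ 2 + 2 * c1 * c2 = 2 * d0 ->
  2 * c0 * c1 + (n ^+ 2 + n - 1) * c2 ^+ 2 + 2 * (n + 2) * c1 * c2 = 2 * d1 ->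
  c1 ^+ 2 + 2 * c0 * c2 + (n ^+ 2 - n + 3) * c2 ^+ 2
       + 2 * (n - 1) * c1 * c2 = 2 * d2 ->
  exists e0 e1 e2 : int, [/\ c0 = 2 * e0, c1 = 2 * e1 & c2 = 2 * e2].
Proof.
pose f (x : int) : 'F_2 := x%:~R.
move=> /(congr1 f) + /(congr1 f) + /(congr1 f).
rewrite {}/f !(rmorphD, rmorphN, rmorphM, rmorphXn) /=.
have : [/\ c0%:~R = 0 :> 'F_2, c1%:~R = 0 :> 'F_2 & c2%:~R = 0 :> 'F_2] ->
  exists d0 d1 d2 : int, [/\ c0 = 2 * d0, c1 = 2 * d1 & c2 = 2 * d2].
  by case=> /F2_even[e0 ->] /F2_even[e1 ->] /F2_even[e2 ->]; exists e0, e1, e2.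
have -> : 1%:~R + 1%:~R = 0 :> 'F_2 by apply/val_inj.
rewrite !mul0r => concl E0 E1 E2; apply: concl; move: E0 E1 E2.
by case: (F2_cases n%:~R) => ->; case: (F2_cases c0%:~R) => ->;
  case: (F2_cases c1%:~R) => ->; case: (F2_cases c2%:~R) => ->
  /eqP + /eqP + /eqP.
Qed.

(** * Divisibility by the conductor *)

Lemma squarefree_dvd_cube (m k e : int) : squarefree m -> coprimez m k ->
  (m %| k * e ^+ 3)%Z -> (m %| e)%Z.
Proof.
move=> sqm mk; rewrite Gauss_dvdzr // => me.
have m0 : m != 0.
  apply/eqP => m0; have := sqm 0; rewrite m0 dvdzz => /(_ isT).
  by rewrite normr0.
(* Write m = m1 g and e = e1 g. Then m1 is prime to e1, hence divides g^2, while squarefreeness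
   makes m1 prime to g; so m1 is a unit. *)
set g := gcdz m e.
have g0 : g != 0 by rewrite gcdz_eq0 (negPf m0).
have /dvdzP[m1 Em] : (g %| m)%Z by rewrite dvdz_gcdl.
have /dvdzP[e1 Ee] : (g %| e)%Z by rewrite dvdz_gcdr.
have m1e1 : coprimez m1 e1.
  apply/eqP/(mulIf g0); rewrite mul1r.
  by have := mulz_gcdl m1 e1 g; rewrite -Em -Ee.
have m1g : (m1 %| g ^+ 2)%Z.
  move: me; rewrite {1}Em Ee.
  have -> : (e1 * g) ^+ 3 = (e1 ^+ 3 * g ^+ 2) * g by ring.
  by rewrite dvdz_mul2r // Gauss_dvdzr // coprimezXr.
set h := gcdz m1 g.
have h1 : `|h| = 1.
  apply: sqm; rewrite Em expr2; apply: dvdz_mul; first exact: dvdz_gcdl.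
  exact: dvdz_gcdr.
have m1g1 : coprimez m1 g by apply/eqP; rewrite -h1 ger0_norm.
have m11 : (m1 %| 1%R)%Z.
  have <- : gcdz m1 (g ^+ 2) = 1 by apply/eqP; apply: coprimezXr.
  by rewrite dvdz_gcd dvdzz.
by rewrite Em Ee; apply: dvdz_mul => //; apply: dvdz_trans m11 (dvd1z _).
Qed.


Lemma coprimezB (x y u v : int) : x * u + y * v = 1 -> coprimez x y.
Proof.
move=> E; apply/coprimezP; exists (u, v); rewrite /= -E; ring.
Qed.

(* The minimal polynomial y^3 - 3 m y - m (2 n + 1) of 3 t - (n - 1) is
   Eisenstein at every prime dividing the conductor m. *)
Lemma cond_dvd_norm (n c0 c1 c2 e : int) : squarefree (conductor n) ->
  normf n c0 c1 c2 = conductor n ^+ 3 * e ->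
  [/\ (conductor n %| c0)%Z, (conductor n %| c1)%Z & (conductor n %| c2)%Z].
Proof.
set m := conductor n => sqm H.
set a := n - 1.
(* With y = 3 t - a, one has 9 (c0 + c1 t + c2 t^2) = e0 + e1 y + c2 y^2. *)
pose e0 := 9 * c0 + 3 * a * c1 + a ^+ 2 * c2.
pose e1 := 3 * c1 + 2 * a * c2.
have m0 : m != 0.
  by apply/eqP; rewrite /m /conductor; nia.
(* For n = 1 modulo 3 the conductor is divisible by 9, against squarefreeness; otherwise it is 1
   modulo 3. *)
have m3 : coprimez m 3.
  have [] : (exists k, n = 3 * k) \/ (exists k, n = 3 * k + 1) \/
            exists k, n = 3 * k + 2.
    have : n = 3 * (n %/ 3)%Z + (n %% 3)%Z by rewrite mulrC -divz_eq.
    have := modz_ge0 n (isT : (3 : int) != 0).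
    have := ltz_pmod n (isT : (0 : int) < 3).
    set r := (n %% 3)%Z; set q := (n %/ 3)%Z => r3 r0 E.
    have [Er|[Er|Er]] : r = 0 \/ r = 1 \/ r = 2 by lia.
    - by left; exists q; lia.
    - by right; left; exists q; lia.
    - by right; right; exists q; lia.
  - case=> k E; apply: (@coprimezB _ _ 1 (-(3 * k ^+ 2 + k + 2))).
    by rewrite /m /conductor E; ring.
  case=> [[k E]|[k E]]; last first.
    apply: (@coprimezB _ _ 1 (-(3 * k ^+ 2 + 5 * k + 4))).
    by rewrite /m /conductor E; ring.
  have : (3 ^+ 2 %| m)%Z.
    apply/dvdzP; exists (k ^+ 2 + k + 1).
    by rewrite /m /conductor E; ring.
  by move/sqm.
(* A common divisor of m and 2 n + 1 divides 4 m - (2 n + 1)^2 = 27, which is prime to m. *)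
have m2n : coprimez m (2 * n + 1).
  have : coprimez m (3 ^+ 3) by apply: coprimezXr.
  case/coprimezP => -[u v] /= E.
  apply: (@coprimezB _ _ (u + 4 * v) (- v * (2 * n + 1))).
  by rewrite -[RHS]E /m /conductor; ring.
(* The norm recomputed in the powers of y; the factor 729 is 9^3. *)
have N : norm_sym 0 (- 3 * m) (m * (2 * n + 1)) e0 e1 c2 = m ^+ 3 * (729 * e).
  have -> : m ^+ 3 * (729 * e) = 729 * normf n c0 c1 c2 by rewrite H; ring.
  by rewrite /normf /norm_sym /e0 /e1 /m /conductor /a; ring.
(* Modulo m the norm is e0^3; once m divides e0, it is m (2 n + 1) e1^3 modulo m^2; once m divides
   e1 too, it is (m (2 n + 1))^2 c2^3 modulo m^3. So m divides each coordinate in turn. *)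
have /dvdzP[f0 E0] : (m %| e0)%Z.
  apply: (@squarefree_dvd_cube m 1) => //.
    by apply: (@coprimezB _ _ 0 1); rewrite mulr0 add0r mulr1.
  rewrite mul1r; apply/dvdzP; move: N; rewrite /norm_sym.
  set r := 2 * n + 1 => N.
  exists (m ^+ 2 * (729 * e) + (6 * e0 ^+ 2 * c2 * -1 + 3 * e0 * e1 ^+ 2
   + 3 * e0 * e1 * c2 * r - 9 * m * e0 * c2 ^+ 2 - e1 ^+ 3 * r
   + 3 * m * e1 * c2 ^+ 2 * r - c2 ^+ 3 * m * r ^+ 2)).
  rewrite mulrDl.
  have -> : m ^+ 2 * (729 * e) * m = m ^+ 3 * (729 * e) by ring.
  rewrite -N; ring.
have /dvdzP[f1 E1] : (m %| e1)%Z.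
  apply: (@squarefree_dvd_cube m (2 * n + 1)) => //.
  rewrite -(@dvdz_mul2r m) //.
  move: N; rewrite /norm_sym E0.
  set r := 2 * n + 1 => N.
  apply/dvdzP; exists (m * (729 * e) - (f0 ^+ 3 * m
     + f0 ^+ 2 * c2 * 6 * m - 3 * f0 * e1 ^+ 2 - 3 * f0 * e1 * c2 * r
     + 9 * m * f0 * c2 ^+ 2 - 3 * e1 * c2 ^+ 2 * r + c2 ^+ 3 * r ^+ 2)).
  rewrite mulrBl.
  have -> : m * (729 * e) * (m * m) = m ^+ 3 * (729 * e) by ring.
  rewrite -N; ring.
have /dvdzP[f2 E2] : (m %| c2)%Z.
  apply: (@squarefree_dvd_cube m ((2 * n + 1) ^+ 2)) => //.
    by apply: coprimezXr.
  rewrite -(@dvdz_mul2r (m * m)) ?mulf_neq0 //.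
  move: N; rewrite /norm_sym E0 E1.
  set r := 2 * n + 1 => N.
  apply/dvdzP; exists (729 * e - (f0 ^+ 3 
     + f0 ^+ 2 * c2 * 6 - 3 * f0 * f1 ^+ 2 * m - 3 * f0 * f1 * c2 * r
     + 9 * f0 * c2 ^+ 2 + f1 ^+ 3 * m * r - 3 * f1 * c2 ^+ 2 * r)).
  rewrite mulrBl.
  have -> : 729 * e * (m * (m * m)) = m ^+ 3 * (729 * e) by ring.
  rewrite -N; ring.
(* The change of coordinates is undone by cancelling 3 and 9, which are prime to m. *)
have dm1 : (m %| c1)%Z.
  rewrite -(@Gauss_dvdzr m 3) //; apply/dvdzP; exists (f1 - 2 * a * f2).
  by rewrite mulrBl -E1 /e1 E2; ring.
split=> //; last by rewrite E2 dvdz_mull.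
have /dvdzP[g1 G1] := dm1.
rewrite -(@Gauss_dvdzr m (3 ^+ 2)) ?coprimezXr //; apply/dvdzP.
exists (f0 - 3 * a * g1 - a ^+ 2 * f2).
by rewrite !mulrBl -E0 /e0 E2 G1; ring.
Qed.

(** * The equation 4 s^3 = (n^2 + n + 7)^2 + 27 *)

Section CubeGaps.

Local Open Scope Z_scope.

(** Determines the integral cube root of v / 4 bit by bit from the top. Thirteen bits suffice for n
    <= 1000, where v stays below 4 * 8192^3. *)
Fixpoint cube_search (v lo : Z) (k : nat) : Z :=
  if k is k'.+1 then
    let mid := (lo + 2 ^ Z.of_nat k') in
    cube_search v (if (4 * (mid * mid * mid) <=? v) then mid else lo) k'
  else lo.

(* Only the two final comparisons matter: the search merely guesses the cube
   root. *)
Definition cube_gap (v : Z) : bool :=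
  let k := cube_search v 0 13 in
  ((4 * (k * k * k) <? v) && (v <? 4 * ((k + 1) * (k + 1) * (k + 1)))).

Arguments cube_gap : simpl never.

Definition mordell_rhs (n : Z) : Z :=
  ((n * n + n + 7) * (n * n + n + 7) + 27).

Fixpoint all_from (p : Z -> bool) (n : Z) (k : nat) : bool :=
  if k is k'.+1 then p n && all_from p (n + 1) k' else true.

Lemma all_fromP p n k j :
  all_from p n k -> n <= j < n + Z.of_nat k -> p j.
Proof.
elim: k n => [|k IH] n; first by lia.
move=> /= /andP[H /IH{}IH] hj; have [->//|nj] := Z.eq_dec j n.
by apply: IH; lia.
Qed.

Lemma cube_le (x y : Z) : x <= y -> x * x * x <= y * y * y.
Proof.
move=> xy; have : 0 <= (y - x) * (x * x + x * y + y * y); last by nia.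
by apply: Z.mul_nonneg_nonneg; nia.
Qed.

Lemma cube_gapP v s : cube_gap v -> (4 * (s * s * s)) <> v.
Proof.
rewrite /cube_gap; set k := cube_search v 0 13.
move=> /andP[/Z.ltb_spec0 lo /Z.ltb_spec0 hi] E.
have [les|les] := Z.le_gt_cases s k.
  by have := cube_le les; lia.
by have := @cube_le (k + 1) s; lia.
Qed.

(** The range starts at 100 because the symmetry n |-> - n - 1 of n^2 + n + 7, used for negative n,
    sends -101 to 100. *)
Lemma cube_gaps_1000 : all_from (fun n => cube_gap (mordell_rhs n)) 100 901.
Proof. by vm_compute. Qed.

End CubeGaps.

Lemma no_cube (n s : int) : -1000 <= n <= 1000 ->
  4 * s ^+ 3 = (n ^+ 2 + n + 7) ^+ 2 + 27 -> -100 <= n <= 100.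
Proof.
have half (k t : int) : 0 <= k <= 1000 ->
    4 * t ^+ 3 = (k ^+ 2 + k + 7) ^+ 2 + 27 -> k < 100.
  move=> hk E; rewrite ltNge; apply/negP => k100.
  have [kz Ek] : exists kz : Z, kz = ssrZ.Z_of_int k by exists (ssrZ.Z_of_int k).
  have [tz Et] : exists tz : Z, tz = ssrZ.Z_of_int t by exists (ssrZ.Z_of_int t).
  have hkz : (Z.le 100 kz /\ Z.lt kz (Z.add 100 (Z.of_nat 901))) by lia.
  apply: (cube_gapP (s := tz) (all_fromP cube_gaps_1000 hkz)); rewrite /mordell_rhs.
  lia.
move=> hn E.
have [n0|n0] := lerP 0 n; first by have := half n s; lia.
have := half (- n - 1) s.
have -> : (- n - 1) ^+ 2 + (- n - 1) + 7 = n ^+ 2 + n + 7 by ring.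
lia.
Qed.

(** * Conjugates and norms *)

Definition quad (R : comNzRingType) (c0 c1 c2 u : R) : R :=
  c0 + c1 * u + c2 * u ^+ 2.

Lemma quadM (R : comNzRingType) (n u c0 c1 c2 d0 d1 d2 : R) :
  u ^+ 3 = (n - 1) * u ^+ 2 + (n + 2) * u + 1 ->
  quad c0 c1 c2 u * quad d0 d1 d2 u =
  quad (c0 * d0 + (c1 * d2 + c2 * d1) + (n - 1) * (c2 * d2))
       (c0 * d1 + c1 * d0 + (n + 2) * (c1 * d2 + c2 * d1)
        + (n ^+ 2 + n - 1) * (c2 * d2))
       (c0 * d2 + c1 * d1 + c2 * d0 + (n - 1) * (c1 * d2 + c2 * d1)
        + (n ^+ 2 - n + 3) * (c2 * d2)) u.
Proof.
move=> u_root.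
apply: (mod_cubic u_root (q := c2 * d2 * (u + n - 1) + c1 * d2 + c2 * d1)).
by rewrite /quad; ring.
Qed.

(** * Rational and algebraic integers in K *)

Section IntegersInField.

Variable K : fieldExtType rat.

Lemma intrK_eq0 (z : int) : (z%:~R == 0 :> K) = (z == 0).
Proof. by rewrite -(rmorph_int (in_alg K)) fmorph_eq0 intr_eq0. Qed.

Lemma intrK_inj : injective (intr : int -> K).
Proof.
move=> x y /eqP; rewrite -subr_eq0 -rmorphB /= intrK_eq0 subr_eq0.
by move/eqP.
Qed.

(** Z is integrally closed. The fact is imported from [algC]: x is the image of the rational c / d,
    and a monic integer polynomial vanishing at x in K also vanishes at c / d in [algC]. *)
Lemma integral_rational (x : K) (d c : int) : d != 0 -> d%:~R * x = c%:~R ->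
  integralOver (intr : int -> K) x -> exists e : int, x = e%:~R /\ c = d * e.
Proof.
move=> d0 Ex [p mon_p px].
have dK : d%:~R != 0 :> K by rewrite intrK_eq0.
pose q : rat := c%:~R / d%:~R.
have Eq : x = in_alg K q.
  apply: (mulfI dK); rewrite Ex /q fmorph_div !rmorph_int.
  by rewrite mulrC divfK.
have Aq : ratr q \in Aint.
  apply: (@root_monic_Aint (map_poly intr p)).
  - move: px; rewrite Eq.
    have -> : map_poly intr p = map_poly (in_alg K) (map_poly intr p) :> {poly K}.
      by rewrite -map_poly_comp; apply: eq_map_poly => z; rewrite /= -(rmorph_int (in_alg K)).
    rewrite fmorph_root => rq.
    have -> : map_poly intr p = map_poly ratr (map_poly intr p) :> {poly algC}.
      by rewrite -map_poly_comp; apply: eq_map_poly => z; rewrite /= ratr_int.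
    by rewrite fmorph_root.
  - exact: monic_map.
  - apply/polyOverP => j; rewrite coef_map /=; exact: intr_int.
have /intrP[e Ee] : ratr q \in (Num.int : {pred algC}).
  by apply: Cint_rat_Aint => //; exact: Crat_rat.
exists e.
have {}Ee : q = e%:~R by apply: (fmorph_inj (@ratr algC)); rewrite /= Ee ratr_int.
have Exe : x = e%:~R by rewrite Eq Ee rmorph_int.
by split=> //; apply: intrK_inj; rewrite -Ex Exe rmorphM.
Qed.

Lemma common_denominator (I : finType) (k : I -> rat) :
  exists (d : int) (z : I -> int), d != 0 /\ forall j, d%:~R * k j = (z j)%:~R.
Proof.
exists (\prod_j denq (k j)), (fun j => numq (k j) * \prod_(l | l != j) denq (k l)).
split; first by apply/prodf_neq0 => j _; exact: denq_neq0.
move=> j; rewrite (bigD1 j) //= !rmorphM /= mulrAC; congr (_ * _).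
by rewrite -{2}[k j]divq_num_den mulrC divfK // intr_eq0 denq_neq0.
Qed.

End IntegersInField.

(** * Triples of conjugates in Z[t] *)

Section Conjugates.

Variables (K : fieldExtType rat) (n : int) (t : K).
Hypothesis t_root :
  t ^+ 3 = (n%:~R - 1) * t ^+ 2 + (n%:~R + 2) * t + 1.
Let t1 := conj1 n%:~R t.
Let t2 := conj2 n%:~R t.

(** A relation on triples instead of a Galois action: norms and traces are then available before any
    automorphism of K is known to exist. *)
Definition conjs (x y z : K) : Prop :=
  exists c0 c1 c2 : int, [/\ x = quad c0%:~R c1%:~R c2%:~R t,
    y = quad c0%:~R c1%:~R c2%:~R t1 & z = quad c0%:~R c1%:~R c2%:~R t2].

Let t1_root : t1 ^+ 3 = (n%:~R - 1) * t1 ^+ 2 + (n%:~R + 2) * t1 + 1.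
Proof. exact: conj1_root. Qed.

Let t12 : conj1 n%:~R t1 = t2. Proof. exact: conj11. Qed.

Let t2_root : t2 ^+ 3 = (n%:~R - 1) * t2 ^+ 2 + (n%:~R + 2) * t2 + 1.
Proof. by rewrite -t12; apply: conj1_root. Qed.

Let t20 : conj1 n%:~R t2 = t. Proof. exact: conj12. Qed.

Lemma conjs_int (c : int) : conjs c%:~R c%:~R c%:~R.
Proof. by exists c, 0, 0; rewrite /quad; split; ring. Qed.

Lemma conjs_gen : conjs t t1 t2.
Proof. by exists 0, 1, 0; rewrite /quad; split; ring. Qed.

Lemma conjsD x y z x' y' z' : conjs x y z -> conjs x' y' z' ->
  conjs (x + x') (y + y') (z + z').
Proof.
move=> [c0 [c1 [c2 [-> -> ->]]]] [d0 [d1 [d2 [-> -> ->]]]].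
by exists (c0 + d0), (c1 + d1), (c2 + d2); rewrite /quad; split; ring.
Qed.

Lemma conjsM x y z x' y' z' : conjs x y z -> conjs x' y' z' ->
  conjs (x * x') (y * y') (z * z').
Proof.
move=> [c0 [c1 [c2 [-> -> ->]]]] [d0 [d1 [d2 [-> -> ->]]]].
rewrite (quadM _ _ _ _ _ _ t_root) (quadM _ _ _ _ _ _ t1_root)
  (quadM _ _ _ _ _ _ t2_root).
exists (c0 * d0 + (c1 * d2 + c2 * d1) + (n - 1) * (c2 * d2)).
exists (c0 * d1 + c1 * d0 + (n + 2) * (c1 * d2 + c2 * d1)
        + (n ^+ 2 + n - 1) * (c2 * d2)).
exists (c0 * d2 + c1 * d1 + c2 * d0 + (n - 1) * (c1 * d2 + c2 * d1)
        + (n ^+ 2 - n + 3) * (c2 * d2)).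
by rewrite /quad; split; ring.
Qed.

Lemma conjs_quad (c0 c1 c2 : int) x y z : conjs x y z ->
  conjs (quad c0%:~R c1%:~R c2%:~R x) (quad c0%:~R c1%:~R c2%:~R y)
        (quad c0%:~R c1%:~R c2%:~R z).
Proof.
move=> H; rewrite /quad !expr2.
apply: conjsD (conjsM (conjs_int c2) (conjsM H H)).
exact: conjsD (conjs_int c0) (conjsM (conjs_int c1) H).
Qed.

Lemma conjs_rot x y z : conjs x y z -> conjs y z x.
Proof.
move=> [c0 [c1 [c2 [-> -> ->]]]]; apply: conjs_quad.
(* The coefficients -2, - n, 1 are those of [conj1], which takes t, t1, t2 to t1, t2, t. *)
have := conjs_quad (-2) (- n) 1 conjs_gen.
have E u : quad (-2)%:~R (- n)%:~R 1%:~R u = conj1 n%:~R u.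
  by rewrite /quad /conj1; ring.
by rewrite !E t12 t20.
Qed.

Lemma conjs_norm x y z : conjs x y z ->
  exists N : int, x * y * z = N%:~R /\ (N = 0 -> x = 0).
Proof.
move=> [c0 [c1 [c2 [-> -> ->]]]]; exists (normf n c0 c1 c2); split.
  rewrite /quad (normfE t_root) /normf /norm_sym; ring.
by move=> /normf_eq0[-> -> ->]; rewrite /quad; ring.
Qed.

Lemma conjs_trace x y z : conjs x y z ->
  exists T : int, x + y + z = T%:~R.
Proof.
move=> [c0 [c1 [c2 [-> -> ->]]]]; exists (tracef n c0 c1 c2).
rewrite /quad (tracefE t_root) /tracef; ring.
Qed.

Lemma conjs_trace_sqr x y z : conjs x y z ->
  exists T : int, x ^+ 2 + y ^+ 2 + z ^+ 2 = T%:~R /\ 0 <= T.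
Proof.
move=> [c0 [c1 [c2 [-> -> ->]]]]; rewrite !expr2.
rewrite (quadM _ _ _ _ _ _ t_root) (quadM _ _ _ _ _ _ t1_root)
  (quadM _ _ _ _ _ _ t2_root).
eexists; split; last by apply: (@tracef_sqr_ge0 n c0 c1 c2); reflexivity.
rewrite {1 2 3}/quad (tracefE t_root) /tracef; ring.
Qed.

(* N(x^2 + y^2) = N(x)^2 + N(y)^2 + Tr((x x' y'')^2) + Tr((x y' y'')^2). *)
Lemma norm_sum_sqr x x1 x2 y y1 y2 (a b : int) :
  conjs x x1 x2 -> conjs y y1 y2 ->
  x * x1 * x2 = a%:~R -> y * y1 * y2 = b%:~R ->
  exists r : int, 0 <= r /\
    (x ^+ 2 + y ^+ 2) * (x1 ^+ 2 + y1 ^+ 2) * (x2 ^+ 2 + y2 ^+ 2)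
    = (a ^+ 2 + b ^+ 2 + r)%:~R.
Proof.
move=> Hx Hy Ea Eb.
have Hx1 := conjs_rot Hx; have Hx2 := conjs_rot Hx1.
have Hy1 := conjs_rot Hy; have Hy2 := conjs_rot Hy1.
have [r1 [E1 r1_ge0]] := conjs_trace_sqr (conjsM (conjsM Hx Hx1) Hy2).
have [r2 [E2 r2_ge0]] := conjs_trace_sqr (conjsM (conjsM Hx Hy1) Hy2).
exists (r1 + r2); split; first exact: addr_ge0.
rewrite !rmorphD !rmorphXn /= -Ea -Eb -E1 -E2; ring.
Qed.

(** Replaces the argument that L has a real embedding: x + i y = 0 gives x^2 + y^2 = 0, whose norm
    is at least N(x)^2 + N(y)^2, so both norms vanish. *)
Lemma conjs_free2 (i x x1 x2 y y1 y2 : K) : i ^+ 2 = -1 ->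
  conjs x x1 x2 -> conjs y y1 y2 -> x + i * y = 0 -> x = 0 /\ y = 0.
Proof.
move=> i2 Hx Hy E.
have [a [Ea a0]] := conjs_norm Hx; have [b [Eb b0]] := conjs_norm Hy.
have [r [r_ge0 Er]] := norm_sum_sqr Hx Hy Ea Eb.
have E0 : x ^+ 2 + y ^+ 2 = 0.
  have -> : x ^+ 2 + y ^+ 2 = (x + i * y) * (x - i * y) + (i ^+ 2 + 1) * y ^+ 2.
    by ring.
  by rewrite E i2 addNr !mul0r addr0.
move: Er; rewrite E0 !mul0r => /esym/eqP; rewrite intrK_eq0 => /eqP N0.
by split; [apply: a0 | apply: b0]; nia.
Qed.

Lemma quad_free (c0 c1 c2 : int) : quad c0%:~R c1%:~R c2%:~R t = 0 ->
  [/\ c0 = 0, c1 = 0 & c2 = 0].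
Proof.
move=> E; apply: (@normf_eq0 n); apply/eqP; rewrite -(intrK_eq0 K); apply/eqP.
have -> : (normf n c0 c1 c2)%:~R
    = normf n%:~R c0%:~R c1%:~R c2%:~R :> K by rewrite /normf /norm_sym; ring.
by rewrite -(normfE t_root) -/(quad _ _ _ t) E !mul0r.
Qed.

End Conjugates.

(** * The sextic field and its automorphisms *)

Section Generators.

Variables (K : fieldExtType rat) (n : int).

Let beta_den : (n ^+ 2 + n - 1)%:~R != 0 :> K.
Proof.
rewrite intrK_eq0; apply/eqP.
have [h|[->|[->|h]]] : n <= -2 \/ n = -1 \/ n = 0 \/ 1 <= n by lia.
all: by nia.
Qed.

Lemma horner_cubic (a : K) : (map_poly intr (cubic n)).[a] =
  a ^+ 3 + (n%:~R ^+ 2 + 5) * a ^+ 2 + (n%:~R ^+ 2 + 2 * n%:~R + 6) * a + 1.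
Proof.
rewrite /cubic; set c := n ^+ 2 + 5; set d := n ^+ 2 + 2 * n + 6.
rewrite !mul_polyC !rmorphD /= !map_polyZ !map_polyXn map_polyX rmorph1.
by rewrite !(hornerD, hornerZ, hornerXn, hornerX, hornerC) /c /d; ring.
Qed.

Lemma map_sextic : map_poly intr (sextic n) =
  'X^6 + ((n%:~R ^+ 2 + 5) *: 'X^4 + (n%:~R ^+ 2 + 2 * n%:~R + 6) *: 'X^2 + 1)
  :> {poly K}.
Proof.
rewrite /sextic; set c := n ^+ 2 + 5; set d := n ^+ 2 + 2 * n + 6.
rewrite !mul_polyC !rmorphD /= !map_polyZ !map_polyXn rmorph1 /= -!addrA.
by congr (_ + (_ *: _ + (_ *: _ + _))); rewrite /c /d; ring.
Qed.

Lemma root_sextic (x : K) : root (map_poly intr (sextic n)) x =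
  root (map_poly intr (cubic n)) (x ^+ 2).
Proof.
rewrite !rootE horner_cubic map_sextic !(hornerD, hornerZ, hornerXn, hornerC).
by congr (_ == _); ring.
Qed.

Lemma cubic_gen (a : K) : root (map_poly intr (cubic n)) a ->
  let t := beta_of n a - 1 in
  t ^+ 3 = (n%:~R - 1) * t ^+ 2 + (n%:~R + 2) * t + 1 /\ a = - t ^+ 2.
Proof.
move=> /rootP; rewrite horner_cubic => g0 t.
pose D : K := (n ^+ 2 + n - 1)%:~R.
have DE : D = n%:~R ^+ 2 + n%:~R - 1 by rewrite /D; ring.
have Dt : D * t = a ^+ 2 + (n%:~R ^+ 2 - n%:~R + 3) * a - n%:~R + 1.
  by rewrite /t /beta_of -/D mulrBr mulrC divfK // DE; ring.
have t2 : t ^+ 2 = - a.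
  apply/eqP; rewrite -subr_eq0 opprK.
  have D2 : D ^+ 2 != 0 by rewrite expf_neq0.
  rewrite -(mulrI_eq0 _ (mulfI D2)) mulrDr -exprMn Dt DE.
  (* D^2 (t^2 + a) is the cubic evaluated at a times a + (n - 1)^2. *)
  rewrite -(mul0r (a + (n%:~R ^+ 2 - 2 * n%:~R + 1))) -g0; apply/eqP; ring.
split; last by rewrite t2 opprK.
apply: (mulfI beta_den); rewrite -/D.
have -> : D * t ^+ 3 = - a * (D * t) by rewrite exprS t2; ring.
have -> : D * ((n%:~R - 1) * t ^+ 2 + (n%:~R + 2) * t + 1)
  = (n%:~R - 1) * D * - a + (n%:~R + 2) * (D * t) + D by rewrite t2; ring.
rewrite Dt DE; apply/eqP; rewrite -subr_eq0 -oppr_eq0 -[X in _ == X]g0.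
by apply/eqP; ring.
Qed.

Lemma rmorph_beta_of (s : {rmorphism K -> K}) (a : K) :
  s (beta_of n a) = beta_of n (s a).
Proof.
rewrite /beta_of fmorph_div (rmorphD s) (rmorphD s) (rmorphXn s) (rmorphM s).
by rewrite !(rmorph_int s).
Qed.

Lemma beta_of_sqr (u : K) :
  u ^+ 3 = (n%:~R - 1) * u ^+ 2 + (n%:~R + 2) * u + 1 ->
  beta_of n (- u ^+ 2) = u + 1.
Proof.
move=> u_root; apply: (mulIf beta_den); rewrite /beta_of divfK //.
apply: (mod_cubic u_root (q := u + n%:~R - 1)); ring.
Qed.

Lemma root_cubic_sqr (u : K) :
  u ^+ 3 = (n%:~R - 1) * u ^+ 2 + (n%:~R + 2) * u + 1 ->
  root (map_poly intr (cubic n)) (- u ^+ 2).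
Proof.
move=> u_root; apply/rootP; rewrite horner_cubic.
(* If p denotes the simplest cubic, then [cubic n] at - u^2 is p(u) p(- u); the cofactor is p(-
   u). *)
apply: (mod_cubic u_root (q := - (u ^+ 3 + (n%:~R - 1) * u ^+ 2
   - (n%:~R + 2) * u + 1))); ring.
Qed.

End Generators.

Section Subring.

Variables (K : fieldExtType rat) (P : K -> Prop).
Hypotheses (Pint : forall z : int, P z%:~R)
  (PD : forall x y, P x -> P y -> P (x + y))
  (PM : forall x y, P x -> P y -> P (x * y)).

Lemma subring_horner (p : {poly int}) (x : K) : P x -> P (map_poly intr p).[x].
Proof.
move=> Px; elim/poly_ind: p => [|p c IH]; first by rewrite rmorph0 horner0; exact: (Pint 0).
rewrite rmorphD rmorphM /= map_polyX map_polyC /= !hornerE.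
by apply: PD => //; apply: PM.
Qed.

(** An element of Q(g) is a rational polynomial in g, whose denominators are cleared. It is applied
    to both Z[t] and Z[t, i]. *)
Lemma Fadjoin_subring (g x : K) : P g -> x \in <<1; g>>%VS ->
  exists d : int, d != 0 /\ P (d%:~R * x).
Proof.
move=> Pg /Fadjoin_polyP[p /polyOver1P[q ->] ->].
have [r [d d0 ->]] := rat_poly_scale q.
exists d; split => //.
rewrite map_polyZ hornerZ -map_poly_comp fmorphV rmorph_int /= mulrA divff ?intrK_eq0 //.
rewrite mul1r.
have -> : map_poly (in_alg K \o intr) r = map_poly intr r :> {poly K}.
  by apply: eq_map_poly => z; rewrite /= -(rmorph_int (in_alg K)).
exact: subring_horner.
Qed.

End Subring.

(** * Degree and automorphisms of K *)

Section Automorphisms.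

Variables (K : fieldExtType rat) (n : int) (xi : K).
Hypothesis xi_root : root (map_poly intr (sextic n)) xi.
Hypothesis K_gen : <<1; xi>>%VS = fullv.

Let t := beta_of n (xi ^+ 2) - 1.
Let i := xi / t.

Let t_root : t ^+ 3 = (n%:~R - 1) * t ^+ 2 + (n%:~R + 2) * t + 1.
Proof. by have := xi_root; rewrite root_sextic => /cubic_gen[]. Qed.

Let xi2 : xi ^+ 2 = - t ^+ 2.
Proof. by have := xi_root; rewrite root_sextic => /cubic_gen[]. Qed.

Let t_neq0 : t != 0.
Proof.
apply/eqP => t0; have := conj_prod t_root; rewrite t0 !mul0r => /esym/eqP.
by rewrite oner_eq0.
Qed.

Lemma sqr_imag : i ^+ 2 = -1.
Proof. by rewrite /i expr_div_n xi2 mulNr divff // expf_neq0. Qed.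

(** The elements 1, t, t^2, i, i t, i t^2 are independent by [conjs_free2]. As K is generated by a
    root of the sextic, this bound forces the sextic to be the minimal polynomial of xi. *)
Lemma dim_sextic : (6 <= \dim {:K})%N.
Proof.
pose X := [tuple 1; t; t ^+ 2; i; i * t; i * t ^+ 2].
suff freeX : free X by rewrite -[6%N]/(size X) -(eqP freeX) dimvS ?subvf.
apply/freeP => k; rewrite !big_ord_recl big_ord0 /=.
have [d [z [d0 Ez]]] := common_denominator k.
have kz j x : d%:~R * (k j *: x) = (z j)%:~R * x :> K.
  rewrite -[k j *: x]mulr_algl mulrA; congr (_ * x).
  by rewrite -[RHS](rmorph_int (in_alg K)) -Ez rmorphM rmorph_int.
move=> /(congr1 ( *%R d%:~R)); rewrite !(mulrDr d%:~R) !kz mulr0 => E.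
set j1 : 'I_6 := lift ord0 ord0 in E; set j2 : 'I_6 := lift ord0 _ in E.
set j3 : 'I_6 := lift ord0 _ in E; set j4 : 'I_6 := lift ord0 _ in E.
set j5 : 'I_6 := lift ord0 _ in E.
pose q a b c u : K := quad (z a)%:~R (z b)%:~R (z c)%:~R u.
have q_conjs a b c : conjs n t (q a b c t) (q a b c (conj1 n%:~R t))
    (q a b c (conj2 n%:~R t)).
  by exists (z a), (z b), (z c).
have := conjs_free2 t_root sqr_imag (q_conjs ord0 j1 j2) (q_conjs j3 j4 j5).
case=> [|/(quad_free t_root)[z0 z1 z2] /(quad_free t_root)[z3 z4 z5]].
  by rewrite -E /q /quad; ring.
have {}kz j : z j = 0 -> k j = 0.
  move=> zj; move: (Ez j); rewrite zj => /eqP; rewrite mulf_eq0 intr_eq0 (negPf d0).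
  by move/eqP.
case=> [[|[|[|[|[|[|//]]]]]] jlt]; apply: kz.
- by rewrite -z0; congr z; apply/val_inj.
- by rewrite -z1; congr z; apply/val_inj.
- by rewrite -z2; congr z; apply/val_inj.
- by rewrite -z3; congr z; apply/val_inj.
- by rewrite -z4; congr z; apply/val_inj.
- by rewrite -z5; congr z; apply/val_inj.
Qed.

Lemma minPoly_sextic : minPoly 1 xi = map_poly intr (sextic n).
Proof.
set S : {poly K} := map_poly intr (sextic n).
have [r [SE szr]] : exists r, S = 'X^6 + r /\ (size r < size ('X^6 : {poly K}))%N.
  eexists; split; first exact: map_sextic.
  rewrite addrA size_polyXn; apply: leq_ltn_trans (size_polyD _ _) _.
  rewrite gtn_max size_poly1 andbT; apply: leq_ltn_trans (size_polyD _ _) _.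
  rewrite gtn_max; apply/andP; split; apply: leq_ltn_trans (size_scale_leq _ _) _;
    by rewrite size_polyXn.
have szS : size S = 7%N by rewrite SE size_polyDl // size_polyXn.
have monS : S \is monic.
  by rewrite monicE SE lead_coefDl // lead_coefXn.
have dvdS : minPoly 1 xi %| S.
  apply: minPoly_dvdp => //; apply/polyOverP => j.
  by rewrite coef_map /= -(rmorph_int (in_alg K)) rpredZ ?mem1v.
apply/eqP; rewrite -eqp_monic ?monic_minPoly // -dvdp_size_eqp // eqn_leq.
rewrite dvdp_leq ?monic_neq0 // szS size_minPoly ltnS.
by have := dim_Fadjoin 1 xi; rewrite K_gen dimv1 muln1 => <-; apply: dim_sextic.
Qed.

Lemma sextic_endomorphism (eta : K) : root (map_poly intr (sextic n)) eta ->
  exists s : {rmorphism K -> K}, s xi = eta.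
Proof.
move=> eta_root.
have root1 : root (map_poly (\1%VF : 'End(K)) (minPoly 1 xi)) eta.
  have -> : map_poly (\1%VF : 'End(K)) (minPoly 1 xi) = minPoly 1 xi.
    by apply: map_poly_id => x _; rewrite lfunE.
  by rewrite minPoly_sextic.
have := kHomExtendP (subvv 1) (kHom1 1 1) root1.
rewrite K_gen => /kHom_monoid_morphism fM.
pose fmM := GRing.isMonoidMorphism.Build _ _ _ fM.
pose s : {rmorphism _ -> _} :=
  HB.pack (fun_of_lfun (kHomExtend 1 \1 xi eta)) fmM.
by exists s; apply: (kHomExtend_val (kHom1 1 1) root1).
Qed.

Let t1 := conj1 n%:~R t.

Lemma exists_rotation :
  exists s : {rmorphism K -> K}, s t = t1 /\ s i = i.
Proof.
have t1_root := conj1_root t_root; rewrite -/t1 in t1_root.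
(* As xi = i t, an automorphism fixing i and moving t to t1 must send xi to i t1. *)
have [|s s_xi] := @sextic_endomorphism (i * t1).
  by rewrite root_sextic exprMn sqr_imag mulN1r root_cubic_sqr.
have s_t : s t = t1.
  rewrite {1}/t rmorphB rmorph1 rmorph_beta_of rmorphXn /= s_xi exprMn sqr_imag.
  by rewrite mulN1r beta_of_sqr // addrK.
have t1_neq0 : t1 != 0 by rewrite -s_t fmorph_eq0.
by exists s; split=> //; rewrite /i fmorph_div s_xi s_t mulfK.
Qed.

Lemma exists_conjugation :
  exists s : {rmorphism K -> K}, s t = t /\ s i = - i.
Proof.
(* The map xi |-> - xi fixes alpha, hence t, and negates i = xi / t. *)
have [|s s_xi] := @sextic_endomorphism (- xi).
  by rewrite root_sextic sqrrN -root_sextic.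
have s_t : s t = t.
  by rewrite {1}/t rmorphB rmorph1 rmorph_beta_of rmorphXn /= s_xi sqrrN.
by exists s; split=> //; rewrite /i fmorph_div s_xi s_t mulNr.
Qed.

End Automorphisms.

(** * Rings of integers, units and monogenicity *)

Lemma mulz_eq1 (x y : int) : x * y = 1 -> x = 1 \/ x = -1.
Proof.
move=> /(congr1 absz); rewrite abszM => /eqP; rewrite muln_eq1 => /andP[/eqP x1 _].
lia.
Qed.

(* T, S, N are the coefficients of the characteristic polynomial of a unit b
   such that b + b' is a unit too and b generates Z[t]. When T S = 0 the
   discriminant condition reads 4 s^3 = conductor^2 + 27 with s = - S or
   s = - T N. *)
Lemma charpoly_bound (n T S N e : int) : -1000 <= n <= 1000 ->
  N = 1 \/ N = -1 -> e = 1 \/ e = -1 -> T * S - N = e ->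
  T ^+ 2 * S ^+ 2 - 4 * S ^+ 3 - 4 * T ^+ 3 * N + 18 * T * S * N - 27 * N ^+ 2
    = conductor n ^+ 2 -> -100 <= n <= 100.
Proof.
rewrite /conductor => hn hN he hTS disc.
have N2 : N ^+ 2 = 1 by case: hN => ->.
have [TS0|TS0] := eqVneq (T * S) 0.
  have /orP[/eqP T0|/eqP S0] : (T == 0) || (S == 0) by rewrite -mulf_eq0 TS0.
    by apply: (@no_cube n (- S)) => //; rewrite -disc T0 N2; ring.
  apply: (@no_cube n (- T * N)) => //; rewrite -disc S0 N2.
  have -> : (- T * N) ^+ 3 = - T ^+ 3 * N * N ^+ 2 by ring.
  by rewrite N2; ring.
(* T S = N + e is a sum of two signs, so it is 2 or -2 when nonzero. Then T and S are so small that
   the discriminant bounds n. *)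
have TS2 : (absz T * absz S = 2)%N.
  rewrite -abszM; move: (T * S) TS0 hTS hN he; clear; lia.
have T2 : (absz T <= 2)%N by apply: dvdn_leq => //; rewrite -TS2 dvdn_mulr.
have S2 : (absz S <= 2)%N by apply: dvdn_leq => //; rewrite -TS2 dvdn_mull.
have small : (n ^+ 2 + n + 7) ^+ 2 <= 200.
  rewrite -disc; clear - hN T2 S2.
  have hT : T = -2 \/ T = -1 \/ T = 0 \/ T = 1 \/ T = 2 by lia.
  have hS : S = -2 \/ S = -1 \/ S = 0 \/ S = 1 \/ S = 2 by lia.
  clear - hN hT hS; case: hN => ->; case: hT => [->|[->|[->|[->|->]]]];
    case: hS => [->|[->|[->|[->|->]]]]; clear; lia.
clear - small.
have : n ^+ 2 + n + 7 <= 15.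
  by rewrite leNgt; apply/negP => h; nia.
by clear; nia.
Qed.

Section RingsOfIntegers.

Variables (K : fieldExtType rat) (n : int) (t i : K).
Variables (sigma tau : {rmorphism K -> K}).
Hypothesis t_root :
  t ^+ 3 = (n%:~R - 1) * t ^+ 2 + (n%:~R + 2) * t + 1.
Hypothesis i2 : i ^+ 2 = -1.
Hypothesis sigma_t : sigma t = conj1 n%:~R t.
Hypothesis sigma_i : sigma i = i.
Hypothesis tau_t : tau t = t.
Hypothesis tau_i : tau i = - i.
Hypothesis sqfree : squarefree (conductor n).

Let t1 := conj1 n%:~R t.
Let t2 := conj2 n%:~R t.
Let m : K := conductor n%:~R.
Local Notation integral := (integralOver (intr : int -> K)).

Definition in_Zt (x : K) := exists y z, conjs n t x y z.

Definition in_Zti (x : K) :=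
  exists a b, [/\ in_Zt a, in_Zt b & x = a + i * b].

Let t1_root : t1 ^+ 3 = (n%:~R - 1) * t1 ^+ 2 + (n%:~R + 2) * t1 + 1.
Proof. exact: conj1_root. Qed.

Lemma rmorph_quad (s : {rmorphism K -> K}) (c0 c1 c2 : int) u :
  s (quad c0%:~R c1%:~R c2%:~R u) = quad c0%:~R c1%:~R c2%:~R (s u).
Proof.
rewrite /quad (rmorphD s) (rmorphD s) [s (_ * u)]rmorphM [s (_ * u ^+ 2)]rmorphM.
by rewrite rmorphXn !(rmorph_int s).
Qed.

Lemma sigma_t1 : sigma t1 = t2.
Proof.
rewrite /t2 -(conj11 t_root) -/t1 {1}/t1 /conj1 !(rmorphB sigma) (rmorphXn sigma).
by rewrite (rmorphM sigma) rmorph_int rmorph_nat sigma_t.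
Qed.

Lemma conjs_sigma x y z : conjs n t x y z ->
  [/\ sigma x = y, sigma y = z & sigma z = x].
Proof.
have t2E : sigma t2 = t.
  rewrite /t2 -(conj11 t_root) -/t1 /conj1 !(rmorphB sigma) (rmorphXn sigma).
  rewrite (rmorphM sigma) rmorph_int rmorph_nat sigma_t1.
  exact: (conj12 t_root).
move=> [c0 [c1 [c2 [-> -> ->]]]].
by rewrite !rmorph_quad sigma_t -/t1 sigma_t1 t2E.
Qed.

Lemma in_ZtP x : in_Zt x -> conjs n t x (sigma x) (sigma (sigma x)).
Proof.
by move=> [y [z H]]; have [Ey Ez _] := conjs_sigma H; rewrite Ey Ez.
Qed.

Lemma in_Zt_quad x : in_Zt x <->
  exists c0 c1 c2 : int, x = quad c0%:~R c1%:~R c2%:~R t.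
Proof.
split; first by case=> y [z [c0 [c1 [c2 [-> _ _]]]]]; exists c0, c1, c2.
by case=> c0 [c1 [c2 ->]]; do 2 eexists; exists c0, c1, c2.
Qed.

Lemma in_Zt_int (z : int) : in_Zt z%:~R.
Proof. by do 2 eexists; apply: conjs_int. Qed.

Lemma in_Zt_gen : in_Zt t.
Proof. by do 2 eexists; apply: conjs_gen. Qed.

Lemma in_ZtD x y : in_Zt x -> in_Zt y -> in_Zt (x + y).
Proof. by move=> [? [? Hx]] [? [? Hy]]; do 2 eexists; apply: conjsD Hx Hy. Qed.

Lemma in_ZtM x y : in_Zt x -> in_Zt y -> in_Zt (x * y).
Proof. by move=> [? [? Hx]] [? [? Hy]]; do 2 eexists; apply: conjsM Hx Hy. Qed.

Lemma in_ZtN x : in_Zt x -> in_Zt (- x).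
Proof. by move=> Hx; rewrite -mulN1r; apply: in_ZtM (in_Zt_int (-1)) Hx. Qed.

Lemma in_Zt_sigma x : in_Zt x -> in_Zt (sigma x).
Proof.
by move=> /in_ZtP H; do 2 eexists; apply: conjs_rot H.
Qed.

Lemma in_Zt_tau x : in_Zt x -> tau x = x.
Proof. by move=> /in_Zt_quad[c0 [c1 [c2 ->]]]; rewrite rmorph_quad tau_t. Qed.

Lemma in_Zt_Zti x : in_Zt x -> in_Zti x.
Proof.
move=> Hx; exists x, 0; split=> //; last by rewrite mulr0 addr0.
exact: (in_Zt_int 0).
Qed.

Lemma in_Zti_imag : in_Zti i.
Proof.
exists 0, 1; split; [exact: (in_Zt_int 0) | exact: (in_Zt_int 1) |].
by rewrite add0r mulr1.
Qed.

Lemma in_ZtiD x y : in_Zti x -> in_Zti y -> in_Zti (x + y).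
Proof.
move=> [a [b [Ha Hb ->]]] [c [d [Hc Hd ->]]]; exists (a + c), (b + d).
split; [exact: in_ZtD | exact: in_ZtD | ring].
Qed.

Lemma in_ZtiM x y : in_Zti x -> in_Zti y -> in_Zti (x * y).
Proof.
move=> [a [b [Ha Hb ->]]] [c [d [Hc Hd ->]]].
exists (a * c + - (b * d)), (a * d + b * c); split.
- by apply: in_ZtD; [|apply: in_ZtN]; apply: in_ZtM.
- by apply: in_ZtD; apply: in_ZtM.
have -> : - (b * d) = i ^+ 2 * (b * d) by rewrite i2 mulN1r.
ring.
Qed.

Lemma in_ZtiN x : in_Zti x -> in_Zti (- x).
Proof.
by move=> Hx; rewrite -mulN1r; apply: in_ZtiM (in_Zt_Zti (in_Zt_int (-1))) Hx.
Qed.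

Lemma in_Zti_sigma x : in_Zti x -> in_Zti (sigma x).
Proof.
move=> [a [b [Ha Hb ->]]]; exists (sigma a), (sigma b).
by rewrite rmorphD rmorphM sigma_i; split; [exact: in_Zt_sigma..|].
Qed.

Lemma in_Zti_tau x : in_Zti x -> in_Zti (tau x).
Proof.
move=> [a [b [Ha Hb ->]]]; exists a, (- b).
by rewrite rmorphD rmorphM tau_i !in_Zt_tau //; split; [|exact: in_ZtN|ring].
Qed.

Lemma integral_gen : integral t.
Proof.
exists ('X^3 - ((n - 1) *: 'X^2 + ((n + 2) *: 'X + 1))).
  rewrite monicE lead_coefDl ?lead_coefXn // size_polyN size_polyXn.
  apply: leq_ltn_trans (size_polyD _ _) _; rewrite gtn_max.
  apply/andP; split.
    by apply: leq_ltn_trans (size_scale_leq _ _) _; rewrite size_polyXn.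
  apply: leq_ltn_trans (size_polyD _ _) _; rewrite gtn_max size_poly1 andbT.
  by apply: leq_ltn_trans (size_scale_leq _ _) _; rewrite size_polyX.
apply/rootP; rewrite !(rmorphB, rmorphD) /= !map_polyZ !map_polyXn map_polyX rmorph1.
rewrite !(hornerD, hornerN, hornerZ, hornerXn, hornerX, hornerC).
by apply: (mod_cubic t_root (q := 1)); ring.
Qed.

Lemma integral_imag : integral i.
Proof.
exists ('X^2 + 1).
  by rewrite monicE lead_coefDl ?lead_coefXn // size_poly1 size_polyXn.
apply/rootP; rewrite !rmorphD /= map_polyXn rmorph1.
by rewrite !(hornerD, hornerXn, hornerC) i2 addNr.
Qed.

Lemma in_Zt_integral x : in_Zt x -> integral x.
Proof.
move=> /in_Zt_quad[c0 [c1 [c2 ->]]]; rewrite /quad expr2.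
by do ?[apply: integral_add | apply: integral_mul | apply: integral_id |
  apply: integral_gen].
Qed.

Lemma in_Zti_integral x : in_Zti x -> integral x.
Proof.
move=> [a [b [/in_Zt_integral Ha /in_Zt_integral Hb ->]]].
exact: integral_add (integral_mul integral_imag Hb).
Qed.

Lemma integral_morph (s : {rmorphism K -> K}) x : integral x -> integral (s x).
Proof.
move=> /(integral_rmorph s)[p mon_p]; exists p => //.
have -> // : map_poly intr p = map_poly (s \o intr) p :> {poly K}.
by apply: eq_map_poly => z; rewrite /= rmorph_int.
Qed.

(* Cramer's rule for the Vandermonde system in the three conjugates of t
   gives m x in Z[t]; the index is then removed by the Eisenstein argument. *)
Lemma integral_in_Zt (x : K) (d : int) : d != 0 -> in_Zt (d%:~R * x) ->
  integral x -> in_Zt x.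
Proof.
move=> d0 [y0 [z0 Hc]] int_x.
have [Ey Ez _] := conjs_sigma Hc.
rewrite rmorphM rmorph_int in Ey; rewrite -{}Ey rmorphM rmorph_int in Ez.
move: Hc => [c0 [c1 [c2 [Ex _ _]]]].
have Ey : d%:~R * sigma x = quad c0%:~R c1%:~R c2%:~R t1.
  by rewrite -[t1]sigma_t -rmorph_quad -Ex rmorphM rmorph_int.
have {z0 Ez} Ez : d%:~R * sigma (sigma x) = quad c0%:~R c1%:~R c2%:~R t2.
  by rewrite -sigma_t1 -rmorph_quad -Ey rmorphM rmorph_int.
have int_y := integral_morph sigma int_x; have int_z := integral_morph sigma int_y.
set y := sigma x in Ey int_y int_z Ez; set z := sigma y in Ez int_z.
have dK : d%:~R != 0 :> K by rewrite intrK_eq0.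
have int_t1 : integral t1 by rewrite -[t1]sigma_t; apply: integral_morph integral_gen.
have int_t2 : integral t2 by rewrite -sigma_t1; apply: integral_morph.
have int_t := integral_gen.
have vdm := vandermonde t_root; rewrite -/t1 -/t2 in vdm.
have mE : m = (conductor n)%:~R by rewrite /m /conductor; ring.
have d_mul u v w : d%:~R * (x * u + y * v + z * w)
    = d%:~R * x * u + d%:~R * y * v + d%:~R * z * w by ring.
(* This combination kills the coefficients of 1 and t and leaves m c2 / d, which is rational and
   integral, hence an integer. The next two isolate c1 and c0. *)
have [e2 [Es2 E2]] : exists e : int,
    x * (t1 - t2) + y * (t2 - t) + z * (t - t1) = e%:~R /\ conductor n * c2 = d * e.
  apply: integral_rational => //.
    by rewrite d_mul Ex Ey Ez rmorphM /= -mE /m -[conductor _]opprK -vdm /quad; ring.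
  by do ?[assumption | apply: integral_sub | apply: integral_add | apply: integral_mul].
have [e1 [Es1 E1]] : exists e : int,
    x * (t2 * t2 - t1 * t1) + y * (t * t - t2 * t2) + z * (t1 * t1 - t * t) = e%:~R
    /\ conductor n * c1 = d * e.
  apply: integral_rational => //.
    by rewrite d_mul Ex Ey Ez rmorphM /= -mE /m -[conductor _]opprK -vdm /quad; ring.
  by do ?[assumption | apply: integral_sub | apply: integral_add | apply: integral_mul].
have [e0 [Es0 E0]] : exists e : int,
    x * (t1 * t2 * (t1 - t2)) + y * (t2 * t * (t2 - t)) + z * (t * t1 * (t - t1)) = e%:~R
    /\ conductor n * c0 = d * e.
  apply: integral_rational => //.
    by rewrite d_mul Ex Ey Ez rmorphM /= -mE /m -[conductor _]opprK -vdm /quad; ring.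
  by do ?[assumption | apply: integral_sub | apply: integral_add | apply: integral_mul].
have m_mul u v : d%:~R * u = quad c0%:~R c1%:~R c2%:~R v ->
    m * u = quad e0%:~R e1%:~R e2%:~R v.
  move=> Eu; apply: (mulfI dK); rewrite mulrCA Eu mE /quad !mulrDr !mulrA.
  by rewrite -!rmorphM /= E0 E1 E2.
(* N(m x) = m^3 N(x) with N(x) an integer, so [cond_dvd_norm] allows division of m x by m inside
   Z[t]. *)
have [e3 [_ E3]] : exists e : int, x * y * z = e%:~R /\
    normf n e0 e1 e2 = conductor n ^+ 3 * e.
  apply: integral_rational.
  - by rewrite expf_neq0 //; apply/eqP; rewrite /conductor; nia.
  - have -> : (conductor n ^+ 3)%:~R * (x * y * z) = m * x * (m * y) * (m * z).
      by rewrite rmorphXn /= -mE; ring.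
    rewrite (m_mul _ _ Ex) (m_mul _ _ Ey) (m_mul _ _ Ez) (normfE t_root).
    by rewrite /normf /norm_sym; ring.
  - by do ?[apply: integral_mul].
have [/dvdzP[f0 F0] /dvdzP[f1 F1] /dvdzP[f2 F2]] := cond_dvd_norm sqfree E3.
apply/in_Zt_quad; exists f0, f1, f2.
have m0 : m != 0 by rewrite mE intrK_eq0; apply/eqP; rewrite /conductor; nia.
apply: (mulfI m0); rewrite (m_mul _ _ Ex) F0 F1 F2 mE /quad; ring.
Qed.

Lemma sqr_Zt_even p r : in_Zt p -> in_Zt r -> p ^+ 2 = 2 * r ->
  exists q, in_Zt q /\ p = 2 * q.
Proof.
move=> /in_Zt_quad[c0 [c1 [c2 ->]]] /in_Zt_quad[d0 [d1 [d2 ->]]].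
rewrite expr2 (quadM _ _ _ _ _ _ t_root) => E.
have [] := quad_free (c0 := c0 * c0 + (c1 * c2 + c2 * c1) + (n - 1) * (c2 * c2) - 2 * d0)
  (c1 := c0 * c1 + c1 * c0 + (n + 2) * (c1 * c2 + c2 * c1)
        + (n ^+ 2 + n - 1) * (c2 * c2) - 2 * d1)
  (c2 := c0 * c2 + c1 * c1 + c2 * c0 + (n - 1) * (c1 * c2 + c2 * c1)
        + (n ^+ 2 - n + 3) * (c2 * c2) - 2 * d2) t_root.
  by apply/eqP; rewrite -(subrr (2 * quad d0%:~R d1%:~R d2%:~R t)) -{1}E;
    apply/eqP; rewrite /quad; ring.
move=> E0 E1 E2.
have [|||e0 [e1 [e2 [-> -> ->]]]] := @sqr_even n c0 c1 c2 d0 d1 d2.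
- by apply/eqP; rewrite -subr_eq0 -[X in _ == X]E0; apply/eqP; ring.
- by apply/eqP; rewrite -subr_eq0 -[X in _ == X]E1; apply/eqP; ring.
- by apply/eqP; rewrite -subr_eq0 -[X in _ == X]E2; apply/eqP; ring.
exists (quad e0%:~R e1%:~R e2%:~R t); split; last by rewrite /quad; ring.
by apply/in_Zt_quad; exists e0, e1, e2.
Qed.

(** Both p = x + tau x and q = - i (x - tau x) lie in Z[t], and 2 x = p + i q. Since p^2 + q^2 = 4 x
    tau(x) and 2 is inert, first p + q and then p is even. *)
Lemma integral_in_Zti (x : K) (d : int) : d != 0 -> in_Zti (d%:~R * x) ->
  integral x -> in_Zti x.
Proof.
move=> d0 [a [b [Ha Hb Ex]]] int_x.
have dK : d%:~R != 0 :> K by rewrite intrK_eq0.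
have two : 2 != 0 :> K by rewrite -[2]/(2%:~R) intrK_eq0.
have int_tx := integral_morph tau int_x.
have Etx : d%:~R * tau x = a - i * b.
  by rewrite -(rmorph_int tau) -rmorphM Ex rmorphD rmorphM tau_i !in_Zt_tau //; ring.
have Hp : in_Zt (x + tau x).
  apply: (integral_in_Zt d0); last exact: integral_add.
  by rewrite mulrDr Ex Etx; have := in_ZtD Ha Ha; congr in_Zt; ring.
have Hq : in_Zt (- i * (x - tau x)).
  apply: (integral_in_Zt d0).
    have -> : d%:~R * (- i * (x - tau x)) = - i ^+ 2 * (b + b).
      have -> : d%:~R * (- i * (x - tau x)) = - i * (d%:~R * x - d%:~R * tau x) by ring.
      by rewrite Ex Etx; ring.
    by rewrite i2 opprK mul1r; apply: in_ZtD.
  by apply: integral_mul (integral_opp integral_imag) (integral_sub _ _).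
set p := x + tau x in Hp; set q := - i * (x - tau x) in Hq.
have Hr : in_Zt (x * tau x).
  apply: (integral_in_Zt (d := d ^+ 2)); first by rewrite expf_neq0.
    have -> : (d ^+ 2)%:~R * (x * tau x) = (d%:~R * x) * (d%:~R * tau x).
      by rewrite rmorphXn /=; ring.
    have -> : (d%:~R * x) * (d%:~R * tau x) = a * a - i ^+ 2 * (b * b).
      by rewrite Ex Etx; ring.
    by rewrite i2 mulN1r opprK; apply: in_ZtD; apply: in_ZtM.
  exact: integral_mul.
have xE : 2 * x = p + i * q.
  have -> : p + i * q = p - i ^+ 2 * (x - tau x) by rewrite /q; ring.
  by rewrite i2 /p; ring.
have pq : p ^+ 2 + q ^+ 2 = 4 * (x * tau x).
  have -> : q ^+ 2 = i ^+ 2 * (x - tau x) ^+ 2 by rewrite /q; ring.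
  by rewrite i2 /p; ring.
have Z2 : in_Zt 2 by exact: (in_Zt_int 2).
have [|r [Hr1 Er]] := @sqr_Zt_even (p + q) (2 * (x * tau x) + p * q)
  (in_ZtD Hp Hq) (in_ZtD (in_ZtM Z2 Hr) (in_ZtM Hp Hq)) _.
  have -> : (p + q) ^+ 2 = p ^+ 2 + q ^+ 2 + 2 * (p * q) by ring.
  by rewrite pq; ring.
have [p' [Hp' Ep]] : exists p', in_Zt p' /\ p = 2 * p'.
  apply: (@sqr_Zt_even p (x * tau x + r * p + - (r * r))) => //.
    do ?[assumption | apply: in_ZtD | apply: in_ZtN | apply: in_ZtM].
  have Eq : q = 2 * r - p by rewrite -Er; ring.
  apply: (mulfI two).
  have -> : 2 * p ^+ 2 = (p ^+ 2 + q ^+ 2) + 4 * (r * p - r ^+ 2) by rewrite Eq; ring.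
  by rewrite pq; ring.
exists p', (r + - p'); split=> //; first by apply/in_ZtD/in_ZtN.
apply: (mulfI two); rewrite xE Ep.
have -> : q = 2 * r - 2 * p' by rewrite -Er -Ep; ring.
by ring.
Qed.

(** * Units of Z[t] and Z[t, i] *)

Lemma Zt_unit_norm b c : in_Zt b -> in_Zt c -> b * c = 1 ->
  exists N : int, b * sigma b * sigma (sigma b) = N%:~R /\ (N = 1 \/ N = -1).
Proof.
move=> Hb Hc bc.
have [N [EN _]] := conjs_norm t_root (in_ZtP Hb).
have [N' [EN' _]] := conjs_norm t_root (in_ZtP Hc).
exists N; split=> //; apply: (@mulz_eq1 N N'); apply: (@intrK_inj K).
rewrite rmorphM /= -EN -EN'.
have -> : b * sigma b * sigma (sigma b) * (c * sigma c * sigma (sigma c))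
  = (b * c) * (sigma b * sigma c) * (sigma (sigma b) * sigma (sigma c)) by ring.
by rewrite -!rmorphM bc !rmorph1 !mulr1.
Qed.

Lemma Zti_mul_tau a b : in_Zt a -> in_Zt b ->
  (a + i * b) * tau (a + i * b) = a ^+ 2 + b ^+ 2.
Proof.
move=> Ha Hb; rewrite rmorphD rmorphM tau_i !in_Zt_tau //.
have -> : (a + i * b) * (a + - i * b) = a ^+ 2 - i ^+ 2 * b ^+ 2 by ring.
by rewrite i2; ring.
Qed.

Lemma Zti_norm_tau x : in_Zti x -> in_Zt (x * tau x).
Proof.
move=> [a [b [Ha Hb ->]]]; rewrite Zti_mul_tau // !expr2.
by apply: in_ZtD; apply: in_ZtM.
Qed.

(** A unit of Z[t, i] lying in Z[t] is a unit of Z[t]: b s = 1 and b tau(s) = 1, so the inverse is b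
    s tau(s). *)
Lemma Zti_unit_norm b s : in_Zt b -> in_Zti s -> b * s = 1 ->
  exists N : int, b * sigma b * sigma (sigma b) = N%:~R /\ (N = 1 \/ N = -1).
Proof.
move=> Hb Hs bs; apply: (@Zt_unit_norm b (b * (s * tau s))) => //.
  by apply: in_ZtM (Zti_norm_tau Hs).
have -> : b * (b * (s * tau s)) = (b * s) * (b * tau s) by ring.
by rewrite -{2}[b]in_Zt_tau // -rmorphM bs rmorph1 mulr1.
Qed.

(* The units of Z[t, i] are those of Z[t] times powers of i: otherwise
   N(a^2 + b^2) >= N(a)^2 + N(b)^2 >= 2. *)
Lemma Zti_unit a b s : in_Zt a -> in_Zt b -> in_Zti s -> (a + i * b) * s = 1 ->
  a = 0 \/ b = 0.
Proof.
move=> Ha Hb Hs us.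
have Hab : in_Zt (a ^+ 2 + b ^+ 2) by rewrite !expr2; apply: in_ZtD; apply: in_ZtM.
have [|N [EN N1]] := Zt_unit_norm Hab (Zti_norm_tau Hs).
  by rewrite -Zti_mul_tau // mulrACA -rmorphM us rmorph1 mulr1.
have [Na [Ea Na0]] := conjs_norm t_root (in_ZtP Ha).
have [Nb [Eb Nb0]] := conjs_norm t_root (in_ZtP Hb).
have [r [r_ge0 Er]] := norm_sum_sqr t_root (in_ZtP Ha) (in_ZtP Hb) Ea Eb.
have ENr : N = Na ^+ 2 + Nb ^+ 2 + r.
  by apply: (@intrK_inj K); rewrite -Er -EN !rmorphD !rmorphXn.
have [/Na0->|Na1] := eqVneq Na 0; first by left.
have [/Nb0->|Nb1] := eqVneq Nb 0; first by right.
have Na2 : 1 <= Na ^+ 2 by nia.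
have Nb2 : 1 <= Nb ^+ 2 by nia.
lia.
Qed.

(** * Obstruction to monogenicity *)

Lemma horner_diff_dvd (p : {poly int}) x y : in_Zti x -> in_Zti y ->
  exists s, in_Zti s /\
    (map_poly intr p).[x] - (map_poly intr p).[y] = (x - y) * s.
Proof.
move=> Hx Hy; have Zint z : in_Zti z%:~R := in_Zt_Zti (in_Zt_int z).
elim/poly_ind: p => [|p c [s [Hs Es]]].
  by exists 0; split; [exact: (Zint 0) | rewrite rmorph0 !horner0 mulr0 subrr].
exists (s * x + (map_poly intr p).[y]); split.
  by apply: in_ZtiD (in_ZtiM Hs Hx) (subring_horner Zint in_ZtiD in_ZtiM _ Hy).
rewrite rmorphD rmorphM /= map_polyX map_polyC /= !(hornerD, hornerM, hornerX, hornerC).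
rewrite mulrDr mulrA -Es; ring.
Qed.

Lemma horner_rmorph (s : {rmorphism K -> K}) (p : {poly int}) x :
  s (map_poly intr p).[x] = (map_poly intr p).[s x].
Proof.
rewrite -horner_map -map_poly_comp; congr _.[_].
by apply: eq_map_poly => z; rewrite /= rmorph_int.
Qed.

Lemma sub_sigma_dvd x : in_Zt x -> exists y, in_Zt y /\ x - sigma x = (t - t1) * y.
Proof.
move=> /in_Zt_quad[c0 [c1 [c2 ->]]]; exists (c1%:~R + c2%:~R * (t + t1)).
have Ht1 : in_Zt t1 by rewrite /t1 -sigma_t; apply: in_Zt_sigma in_Zt_gen.
split; last by rewrite rmorph_quad sigma_t -/t1 /quad; ring.
exact: in_ZtD (in_Zt_int _) (in_ZtM (in_Zt_int _) (in_ZtD in_Zt_gen Ht1)).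
Qed.

Lemma Zti_not_monogenic g : -1000 <= n <= 1000 -> in_Zti g ->
  (forall x, in_Zti x -> exists p : {poly int}, x = (map_poly intr p).[g]) ->
  -100 <= n <= 100.
Proof.
move=> hn Hg gen.
have [a [b [Ha Hb Eg]]] := Hg.
have Zint z : in_Zti z%:~R := in_Zt_Zti (in_Zt_int z).
have two : 2 != 0 :> K by rewrite -[2]/(2%:~R) intrK_eq0.
have i0 : i != 0 by rewrite -sqrf_eq0 i2 oppr_eq0 oner_eq0.
have dvd_sub (f : {rmorphism K -> K}) x : in_Zti x -> in_Zti (f g) ->
    exists s, in_Zti s /\ x - f x = (g - f g) * s.
  by move=> Hx Hfg; have [p ->] := gen x Hx; rewrite horner_rmorph; apply: horner_diff_dvd.
have Ht := in_Zt_Zti in_Zt_gen.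
have Hsg := in_Zti_sigma Hg.
have Ht1 : in_Zt t1 by rewrite /t1 -sigma_t; apply: in_Zt_sigma in_Zt_gen.
have Ht2 : in_Zt t2 by rewrite -sigma_t1; apply: in_Zt_sigma.
have vdm := vandermonde t_root; rewrite -/t1 -/t2 in vdm.
have mE : m = (conductor n)%:~R by rewrite /m /conductor; ring.
have m0 : m != 0 by rewrite mE intrK_eq0; apply/eqP; rewrite /conductor; nia.
have d0 : t - t1 != 0.
  by apply: contraNneq m0 => d0; rewrite /m -oppr_eq0 -vdm d0 !mul0r.
have [sb [Hsb bsb]] : exists s, in_Zti s /\ b * s = 1.
  (* Here g - tau g = 2 i b divides i - tau i = 2 i. *)
  have [s [Hs Es]] := dvd_sub tau i in_Zti_imag (in_Zti_tau Hg).
  exists s; split=> //; apply: (mulfI i0); apply: (mulfI two); rewrite mulr1.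
  have -> : 2 * i = i - tau i by rewrite tau_i; ring.
  by rewrite Es Eg rmorphD rmorphM tau_i !in_Zt_tau //; ring.
have [N [EN N1]] := Zti_unit_norm Hb Hsb bsb.
have [u [Hu Eu]] := sub_sigma_dvd Ha.
have [v [Hv Ev]] := sub_sigma_dvd Hb.
have Esg : g - sigma g = (t - t1) * (u + i * v).
  by rewrite mulrDr mulrCA -Eu -Ev Eg rmorphD rmorphM sigma_i; ring.
have [s [Hs Es]] := dvd_sub sigma t Ht Hsg.
have uvs : (u + i * v) * s = 1.
  by apply: (mulfI d0); rewrite mulrA -Esg -Es sigma_t mulr1.
have [w [Hw Ew]] : exists w, in_Zti w /\ (a - sigma a + i * (b + sigma b)) * w = 1.
  pose f : {rmorphism K -> K} := sigma \o tau.
  have fg : f g = sigma a - i * sigma b.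
    by rewrite /f /= Eg rmorphD rmorphM tau_i !in_Zt_tau // rmorphD rmorphM rmorphN
      sigma_i mulNr.
  have Hfg : in_Zti (f g) by apply/in_Zti_sigma/in_Zti_tau.
  have [s1 [Hs1 Es1]] := dvd_sub f i in_Zti_imag Hfg.
  have [s2 [Hs2 Es2]] := dvd_sub f t Ht Hfg.
  have {}Es1 : (g - f g) * s1 = 2 * i.
    by rewrite -Es1 /f /= tau_i rmorphN sigma_i; ring.
  have {}Es2 : (g - f g) * s2 = t - t1 by rewrite -Es2 /f /= tau_t sigma_t.
  have [k Ek] : exists k : int, conductor n = 2 * k + 1.
    have [q [Eq|Eq]] : exists q : int, n = 2 * q \/ n = 2 * q + 1.
      exists (n %/ 2)%Z.
      have := divz_eq n 2; have := modz_ge0 n (isT : (2 : int) != 0).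
      have := ltz_pmod n (isT : (0 : int) < 2); lia.
    - by exists (2 * q ^+ 2 + q + 3); rewrite /conductor Eq; ring.
    - by exists (2 * q ^+ 2 + 3 * q + 4); rewrite /conductor Eq; ring.
  have {}Ek : 1 = m - 2 * k%:~R by rewrite mE Ek; ring.
  (* From 1 = m - 2 k, where m = - (t - t1)(t1 - t2)(t2 - t) is a multiple of t - t1 and - 2 k = (i
     k)(2 i). *)
  exists (i * k%:~R * s1 + - (s2 * ((t1 - t2) * (t2 - t)))); split.
    apply: in_ZtiD; first exact: in_ZtiM (in_ZtiM in_Zti_imag (Zint k)) Hs1.
    apply/in_ZtiN/(in_ZtiM Hs2)/in_Zt_Zti.
    by apply: in_ZtM; apply: in_ZtD => //; apply: in_ZtN => //; exact: in_Zt_gen.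
  have -> : a - sigma a + i * (b + sigma b) = g - f g by rewrite fg Eg; ring.
  rewrite [RHS]Ek /m -[conductor _]opprK -vdm -Es2.
  rewrite [2 * _]mulrC -[2]opprK -[- 2 : K]mulN1r -i2.
  have -> : i ^+ 2 * 2 = i * (2 * i) by ring.
  by rewrite -Es1; ring.
have Hsb' := in_Zt_sigma Hb.
have Hbb : in_Zt (b + sigma b) := in_ZtD Hb Hsb'.
have bb0 : b + sigma b != 0.
  (* If sigma b = - b, then b = sigma^3 b = - b, against b being a unit. *)
  apply/eqP => E.
  have E1 : sigma b + sigma (sigma b) = 0 by rewrite -rmorphD E rmorph0.
  have E2 : sigma (sigma b) + b = 0.
    have [_ _ E3] := conjs_sigma (in_ZtP Hb).
    by rewrite -{2}E3 -rmorphD E1 rmorph0.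
  have b0 : 2 * b = 0.
    have -> : 2 * b = (b + sigma b) - (sigma b + sigma (sigma b))
      + (sigma (sigma b) + b) by ring.
    by rewrite E E1 E2 subrr addr0.
  move/eqP: b0; rewrite mulf_eq0 (negPf two) /= => /eqP b0.
  by move/eqP: bsb; rewrite b0 mul0r eq_sym oner_eq0.
have Hab : in_Zt (a - sigma a) by apply: in_ZtD => //; apply/in_ZtN/in_Zt_sigma.
have a0 : a - sigma a = 0.
  by case: (Zti_unit Hab Hbb Hw Ew) => // /eqP; rewrite (negPf bb0).
have u0 : u = 0.
  by move/eqP: Eu; rewrite a0 eq_sym mulf_eq0 (negPf d0) => /eqP.
rewrite u0 add0r in uvs; rewrite a0 add0r in Ew.
(* Now i (b + sigma b) w = 1 and i v s = 1, so b + sigma b and v have norm 1 or -1. *)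
have [|e [Ee e1]] := @Zti_unit_norm (b + sigma b) (i * w) Hbb (in_ZtiM in_Zti_imag Hw).
  by rewrite mulrCA mulrA.
have [|c [Ec c1]] := @Zti_unit_norm v (i * s) Hv (in_ZtiM in_Zti_imag Hs).
  by rewrite mulrCA mulrA.
have conjb := in_ZtP Hb.
have [_ _ b3] := conjs_sigma conjb.
have [T ET] := conjs_trace t_root conjb.
have [S ES] := conjs_trace t_root (conjsM t_root conjb (conjs_rot t_root conjb)).
set b1 := sigma b in EN ES ET b3 Ee Ev conjb; set b2 := sigma b1 in EN ES ET b3 Ee conjb.
rewrite rmorphD -/b1 -/b2 in Ee; rewrite rmorphD b3 -/b2 in Ee.
(* The norm of b + b1 is (b + b1)(b1 + b2)(b2 + b) = T S - N. The discriminant of b is m^2 because b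
   - b1 = (t - t1) v with v a unit. *)
apply: (@charpoly_bound n T S N e) => //; apply: (@intrK_inj K).
  by rewrite rmorphB rmorphM /= -ET -ES -EN -Ee; ring.
have Ev1 : b1 - b2 = (t1 - t2) * sigma v.
  by rewrite -rmorphB Ev rmorphM rmorphB sigma_t sigma_t1.
have Ev2 : b2 - b = (t2 - t) * sigma (sigma v).
  have [_ _ t3] := conjs_sigma (conjs_gen n t).
  rewrite -[X in b2 - X]b3 -rmorphB Ev1 rmorphM rmorphB sigma_t1; congr ((_ - _) * _).
  exact: t3.
have disc : ((b - b1) * (b1 - b2) * (b2 - b)) ^+ 2 = m ^+ 2.
  have -> : (b - b1) * (b1 - b2) * (b2 - b)
    = (t - t1) * (t1 - t2) * (t2 - t) * (v * sigma v * sigma (sigma v)).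
    by rewrite Ev Ev1 Ev2; ring.
  by rewrite vdm Ec -/m exprMn sqrrN; case: c1 => ->; rewrite ?rmorphN ?sqrrN expr1n mulr1.
rewrite rmorphXn /= -mE -disc.
rewrite !(rmorphB, rmorphD, rmorphM, rmorphXn) /= -ET -ES -EN; ring.
Qed.

End RingsOfIntegers.

(** * Z-bases with explicit coordinates *)

Section ZBases.

Variables (K : fieldExtType rat) (O : K -> Prop).

Lemma is_Zbasis3 (a b c : K) :
  (forall x, O x <-> exists c0 c1 c2 : int,
     x = a * c0%:~R + b * c1%:~R + c * c2%:~R) ->
  (forall c0 c1 c2 : int, a * c0%:~R + b * c1%:~R + c * c2%:~R = 0 ->
     [/\ c0 = 0, c1 = 0 & c2 = 0]) ->
  is_Zbasis O [tuple a; b; c].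
Proof.
have sumE (k : 'I_3 -> int) : \sum_(j < 3) tnth [tuple a; b; c] j *~ k j =
    a * (k ord0)%:~R + b * (k (lift ord0 ord0))%:~R
    + c * (k (lift ord0 (lift ord0 ord0)))%:~R.
  by rewrite !big_ord_recl big_ord0 /= !(tnth_nth 0) /= !mulrzr addr0 addrA.
move=> gen free; split=> [x|k].
  rewrite gen; split=> [[c0 [c1 [c2 ->]]]|[k ->]].
    by exists (fun j => nth 0 [:: c0; c1; c2] j); rewrite sumE.
  by rewrite sumE; do 3 eexists.
rewrite sumE => /free[k0 k1 k2].
case=> [[|[|[|//]]] jlt].
- by rewrite -k0; congr k; apply/val_inj.
- by rewrite -k1; congr k; apply/val_inj.
- by rewrite -k2; congr k; apply/val_inj.
Qed.

Lemma is_Zbasis6 (a b c a' b' c' : K) :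
  (forall x, O x <-> exists c0 c1 c2 d0 d1 d2 : int,
     x = (a * c0%:~R + b * c1%:~R + c * c2%:~R)
         + (a' * d0%:~R + b' * d1%:~R + c' * d2%:~R)) ->
  (forall c0 c1 c2 d0 d1 d2 : int, (a * c0%:~R + b * c1%:~R + c * c2%:~R)
         + (a' * d0%:~R + b' * d1%:~R + c' * d2%:~R) = 0 ->
     [/\ c0 = 0, c1 = 0 & c2 = 0] /\ [/\ d0 = 0, d1 = 0 & d2 = 0]) ->
  is_Zbasis O [tuple a; b; c; a'; b'; c'].
Proof.
pose j1 : 'I_6 := lift ord0 ord0; pose j2 : 'I_6 := lift ord0 (lift ord0 ord0).
pose j3 : 'I_6 := lift ord0 (lift ord0 (lift ord0 ord0)).
pose j4 : 'I_6 := lift ord0 (lift ord0 (lift ord0 (lift ord0 ord0))).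
pose j5 : 'I_6 := lift ord0 (lift ord0 (lift ord0 (lift ord0 (lift ord0 ord0)))).
have sumE (k : 'I_6 -> int) :
    \sum_(j < 6) tnth [tuple a; b; c; a'; b'; c'] j *~ k j =
    (a * (k ord0)%:~R + b * (k j1)%:~R + c * (k j2)%:~R)
    + (a' * (k j3)%:~R + b' * (k j4)%:~R + c' * (k j5)%:~R).
  by rewrite !big_ord_recl big_ord0 /= !(tnth_nth 0) /= !mulrzr addr0 !addrA.
move=> gen free; split=> [x|k].
  rewrite gen; split=> [[c0 [c1 [c2 [d0 [d1 [d2 ->]]]]]]|[k ->]].
    by exists (fun j => nth 0 [:: c0; c1; c2; d0; d1; d2] j); rewrite sumE.
  by rewrite sumE; do 6 eexists.
rewrite sumE => /free[[k0 k1 k2] [k3 k4 k5]].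
case=> [[|[|[|[|[|[|//]]]]]] jlt].
- by rewrite -k0; congr k; apply/val_inj.
- by rewrite -k1; congr k; apply/val_inj.
- by rewrite -k2; congr k; apply/val_inj.
- by rewrite -k3; congr k; apply/val_inj.
- by rewrite -k4; congr k; apply/val_inj.
- by rewrite -k5; congr k; apply/val_inj.
Qed.

Lemma power_basis_horner (g : K) (d : nat) :
  is_Zbasis O [tuple g ^+ j | j < d] ->
  forall x, O x -> exists p : {poly int}, x = (map_poly intr p).[g].
Proof.
move=> [gen _] x /gen[c ->]; exists (\sum_(j < d) c j *: 'X^j).
rewrite rmorph_sum /= horner_sum; apply: eq_bigr => j _.
by rewrite tnth_mktuple map_polyZ map_polyXn hornerZ hornerXn mulrzl.
Qed.

End ZBases.

(** * Integral bases of L and K and the theorem *)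

Lemma beta_of_mem (K : fieldExtType rat) (E : {subfield K}) (n : int) (a : K) :
  a \in E -> beta_of n a \in E.
Proof.
move=> aE; apply: rpred_div; last exact: rpred_int.
by rewrite !rpredD ?rpredM ?rpredX ?rpred_int.
Qed.

Lemma quad_mem (K : fieldExtType rat) (E : {subfield K}) (c0 c1 c2 : int) (u : K) :
  u \in E -> quad c0%:~R c1%:~R c2%:~R u \in E.
Proof. by move=> uE; rewrite /quad !rpredD ?rpredM ?rpredX ?rpred_int. Qed.

Theorem theorem2 (n : int) (nS : inS n)
    (K : fieldExtType rat) (xi : K)
    (xi_root : root (map_poly intr (sextic n)) xi)
    (K_gen : <<1; xi>>%VS = fullv) :
  let alpha := xi ^+ 2 in
  let beta := beta_of n alpha in
  let L := <<1; alpha>>%VS in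
  [/\ root (map_poly intr (cubic n)) alpha,
      integral_basis L [tuple 1; alpha; beta],
      exists i : K, i ^+ 2 = -1
    & forall i : K, i ^+ 2 = -1 ->
      [/\ (L * <<1; i>>)%VS = fullv,
          integral_basis fullv
            [tuple 1; alpha; beta; i; i * alpha; i * beta]
        & forall x1 x2 x3 y1 y2 y3 : int,
          `|x2| < 10 ^+ 100 -> `|x3| < 10 ^+ 100 ->
          `|y1| < 10 ^+ 100 -> `|y2| < 10 ^+ 100 -> `|y3| < 10 ^+ 100 ->
          ~ power_integral_basis
              (x1%:~R + x2%:~R * alpha + x3%:~R * beta
               + i * y1%:~R + i * y2%:~R * alpha + i * y3%:~R * beta)]].
Proof.
case: nS => n_range sqfree alpha beta L.
have a_root : root (map_poly intr (cubic n)) alpha by rewrite -root_sextic.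
have [t_root alphaE] := cubic_gen a_root.
set t := beta_of n alpha - 1 in t_root alphaE.
have betaE : beta = t + 1 by rewrite /t subrK.
pose i0 := xi / t.
have i02 : i0 ^+ 2 = -1 by apply: sqr_imag xi_root.
have t0 : t != 0.
  apply/eqP => t0; have := conj_prod t_root; rewrite t0 !mul0r => /esym/eqP.
  by rewrite oner_eq0.
have tL : t \in L.
  by apply: rpredB (rpred1 _); apply/beta_of_mem/memv_adjoin.
have in_Zt_L x : in_Zt n t x -> x \in L.
  move=> /in_Zt_quad[c0 [c1 [c2 ->]]].
  exact: quad_mem tL.
(* As alpha = - t^2 and beta = 1 + t, the change between (1, alpha, beta) and (1, t, t^2) is
   unimodular. *)
have quadE (c0 c1 c2 : int) : 1 * c0%:~R + alpha * c1%:~R + beta * c2%:~R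
    = quad (c0 + c2)%:~R c2%:~R (- c1)%:~R t.
  by rewrite alphaE betaE /quad; ring.
have in_ZtE x : in_Zt n t x <-> exists c0 c1 c2 : int,
    x = 1 * c0%:~R + alpha * c1%:~R + beta * c2%:~R.
  rewrite in_Zt_quad; split=> [[c0 [c1 [c2 ->]]]|[c0 [c1 [c2 ->]]]].
    by exists (c0 - c1), (- c2), c1; rewrite quadE opprK subrK.
  by rewrite quadE; do 3 eexists.
have quad_free3 (c0 c1 c2 : int) :
    1 * c0%:~R + alpha * c1%:~R + beta * c2%:~R = 0 -> [/\ c0 = 0, c1 = 0 & c2 = 0].
  by rewrite quadE => /(quad_free t_root)[e0 e1 e2]; split; lia.
have [sigma0 [sigma0_t sigma0_i]] := exists_rotation xi_root K_gen.
have [tau0 [tau0_t tau0_i]] := exists_conjugation xi_root K_gen.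
have Zt_int := in_Zt_int n t.
have Zt_alpha : in_Zt n t alpha.
  rewrite alphaE expr2; apply/in_ZtN/in_ZtM => //; exact: in_Zt_gen.
have Zt_beta : in_Zt n t beta.
  by rewrite betaE; apply: in_ZtD (in_Zt_gen n t) (Zt_int 1).
split=> //; [|by exists i0|].
  apply: is_Zbasis3 => // x; rewrite -in_ZtE; split=> [[xL x_int]|Hx].
    have [d [d0 Hd]] := Fadjoin_subring Zt_int (@in_ZtD _ _ _)
      (in_ZtM t_root) Zt_alpha xL.
    exact: (integral_in_Zt t_root sigma0_t sqfree d0 Hd x_int).
  by split; [exact: in_Zt_L | exact: (in_Zt_integral t_root Hx)].
move=> i i2.
(* Any square root i of -1 is i0 or - i0, so the rotation fixes it and the conjugation negates
   it. *)
have [sigma [tau [sigma_t sigma_i tau_t tau_i]]] : exists (s u : {rmorphism K -> K}),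
    [/\ s t = conj1 n%:~R t, s i = i, u t = t & u i = - i].
  exists sigma0, tau0; split=> //; move/eqP: i2; rewrite -i02 eqf_sqr.
    by case/orP=> /eqP ->; rewrite ?rmorphN sigma0_i.
  by case/orP=> /eqP ->; rewrite ?rmorphN tau0_i.
have xiE : xi = i0 * t by rewrite /i0 divfK.
have i_xi : xi = i * t \/ xi = - (i * t).
  move/eqP: i2; rewrite -i02 eqf_sqr xiE => /orP[]/eqP->; [by left|right].
  by rewrite mulNr opprK.
have Zti_imag := in_Zti_imag n t i.
have Zti_xi : in_Zti n t i xi.
  have H : in_Zti n t i (i * t).
    exact: (in_ZtiM t_root i2 Zti_imag (in_Zt_Zti i (in_Zt_gen n t))).
  by case: i_xi => ->; last apply: in_ZtiN.
have Zti_int z : in_Zti n t i z%:~R := in_Zt_Zti i (Zt_int z).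
have in_ZtiP x : in_Zti n t i x <-> algebraic_integers fullv x.
  split=> [Hx|[_ x_int]].
    by split; [exact: memvf | exact: (in_Zti_integral t_root i2 Hx)].
  have xK : x \in <<1; xi>>%VS by rewrite K_gen memvf.
  have [d [d0 Hd]] := Fadjoin_subring Zti_int (@in_ZtiD _ _ _ _)
    (in_ZtiM t_root i2) Zti_xi xK.
  exact: (integral_in_Zti t_root i2 sigma_t tau_t tau_i sqfree d0 Hd x_int).
split.
- apply/eqP; rewrite eqEsubv subvf /= -K_gen.
  apply/FadjoinP; split; first exact: sub1v.
  (* Up to sign xi is i t, so the composite contains a generator of K. *)
  have H : i * t \in (L * <<1; i>>)%VS by rewrite mulrC memv_mul ?memv_adjoin.
  by case: i_xi => ->; rewrite ?rpredN.
- apply: is_Zbasis6 => [x|c0 c1 c2 d0 d1 d2].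
    rewrite -in_ZtiP; split.
      case=> [a [b [/in_ZtE[c0 [c1 [c2 ->]]] /in_ZtE[d0 [d1 [d2 ->]]] ->]]].
      by exists c0, c1, c2, d0, d1, d2; ring.
    case=> [c0 [c1 [c2 [d0 [d1 [d2 ->]]]]]].
    exists (1 * c0%:~R + alpha * c1%:~R + beta * c2%:~R).
    exists (1 * d0%:~R + alpha * d1%:~R + beta * d2%:~R).
    by split; [apply/in_ZtE; do 3 eexists.. | ring].
  have -> : i * d0%:~R + i * alpha * d1%:~R + i * beta * d2%:~R
    = i * (1 * d0%:~R + alpha * d1%:~R + beta * d2%:~R) by ring.
  have [y [z Ha]] : in_Zt n t (1 * c0%:~R + alpha * c1%:~R + beta * c2%:~R).
    by apply/in_ZtE; do 3 eexists.
  have [y' [z' Hb]] : in_Zt n t (1 * d0%:~R + alpha * d1%:~R + beta * d2%:~R).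
    by apply/in_ZtE; do 3 eexists.
  by move=> /(conjs_free2 t_root i2 Ha Hb)[/quad_free3 ? /quad_free3].
move=> x1 x2 x3 y1 y2 y3 _ _ _ _ _ pib.
have range : -1000 <= n <= 1000 by lia.
suff : -100 <= n <= 100 by lia.
apply: (Zti_not_monogenic t_root i2 sigma_t sigma_i tau_t tau_i range _ _); last first.
  by move=> x /in_ZtiP; apply: (power_basis_horner pib).
have Za := in_Zt_Zti i Zt_alpha; have Zb := in_Zt_Zti i Zt_beta.
do ?[assumption | exact: Zti_int | apply: in_ZtiD | apply: (in_ZtiM t_root i2)].
Qed.
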